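(* Let $\{X^k\}_{k\ge 0}\subset \mathbb{R}^{n\times n}\times\mathcal{O}(n)\times\mathcal{V}$ be a sequence generated by the Riemannian inexact Newton-CG method (described in the context), and let $\overline{X}\in \mathbb{R}^{n\times n}\times\mathcal{O}(n)\times\mathcal{V}$ be an accumulation point of $\{X^k\}$. Suppose that the linear operator $\mathrm{D}G(\overline{X}):T_{\overline{X}}(\mathbb{R}^{n\times n}\times\mathcal{O}(n)\times\mathcal{V})\to T_{G(\overline X)}\mathbb{R}^{n\times n}\simeq\mathbb{R}^{n\times n}$ is surjective. Then the whole sequence $\{X^k\}$ converges to $\overline{X}$, and $G(\overline{X})=\mathbf{0}_{n\times n}$.
   Context: **The equation.** Let $\{\lambda_1,\dots,\lambda_n\}$ be a self-conjugate set (list) of complex numbers, ordered so that $\lambda_{2i-1}=a_i+b_i\sqrt{-1}$, $\lambda_{2i}=a_i-b_i\sqrt{-1}$ with $a_i,b_i\in\mathbb{R}$, $b_i\ne 0$ for $i=1,\dots,s$, and $\lambda_i\in\mathbb{R}$ for $i=2s+1,\dots,n$. Let $\Lambda\in\mathbb{R}^{n\times n}$ be the block diagonal matrix $\Lambda=\mathrm{blkdiag}(\lambda_1^{[2]},\dots,\lambda_s^{[2]},\lambda_{2s+1},\dots,\lambda_n)$ with $\lambda_i^{[2]}=\begin{bmatrix}a_i&b_i\\-b_i&a_i\end{bmatrix}$. Let $\mathcal{O}(n)=\{Q\in\mathbb{R}^{n\times n}: Q^TQ=I_n\}$, $\mathcal{I}=\{(i,j): 1\le i,j\le n,\ i\ge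 j \text{ or } \Lambda_{ij}\neq 0\}$ and $\mathcal{V}=\{V\in\mathbb{R}^{n\times n}: V_{ij}=0 \text{ for } (i,j)\in\mathcal{I}\}$. With $\odot$ the Hadamard (entrywise) product, define the smooth map $$G:\mathbb{R}^{n\times n}\times\mathcal{O}(n)\times\mathcal{V}\to\mathbb{R}^{n\times n},\qquad G(S,Q,V)=S\odot S-Q(\Lambda+V)Q^T .$$ **Geometry.** The product manifold $\mathbb{R}^{n\times n}\times\mathcal{O}(n)\times\mathcal{V}$ has tangent space $\mathbb{R}^{n\times n}\times\{Q\Omega:\Omega\in\mathbb{R}^{n\times n},\Omega^T=-\Omega\}\times\mathcal{V}$ at $(S,Q,V)$, and carries the Riemannian metric $\langle(\xi_1,\zeta_1,\eta_1),(\xi_2,\zeta_2,\eta_2)\rangle=\mathrm{tr}(\xi_1^T\xi_2)+\mathrm{tr}(\zeta_1^T\zeta_2)+\mathrm{tr}(\eta_1^T\eta_2)$, with induced norm $\|\cdot\|$. $\mathbb{R}^{n\times n}$ (the target of $G$, whose tangent spaces are identified with $\mathbb{R}^{n\times n}$) carries the Frobenius inner product and norm $\|\cdot\|_F$. $\mathrm{D}G(X)$ is the differential of $G$ at $X$, $(\mathrm{D}G(X))^*$ its adjoint with respect to these inner products, and $\mathrm{id}$ the identity operator on $\mathbb{R}^{n\times n}$. The retraction $R$ is $R_{(S,Q,V)}(\xi,\zeta,\eta)=(S+\xi,\ \mathrm{qf}(Q+\zeta),\ V+\eta)$, where $\mathrm{qf}(A)$ is the orthogonal factor in the QR decomposition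 $A=Q\widetilde R$ of a nonsingular $A$ with $\widetilde R$ upper triangular with strictly positive diagonal. **Riemannian inexact Newton-CG method.** Step 0: choose $X^0\in\mathbb{R}^{n\times n}\times\mathcal{O}(n)\times\mathcal{V}$, $\overline\sigma_{\max},\overline\eta_{\max},\widehat\eta_{\max}\in[0,1)$, $t\in(0,1)$, $0<\theta_{\min}<\theta_{\max}<1$; set $k=0$. Step 1: with $\overline\sigma_k=\min\{\overline\sigma_{\max},\|G(X^k)\|_F\}$ and $\overline\eta_k=\min\{\overline\eta_{\max},\|G(X^k)\|_F\}$, apply the conjugate gradient (CG) method to $(\mathrm{D}G(X^k)\circ(\mathrm{D}G(X^k))^*+\overline\sigma_k\,\mathrm{id})[\Delta Z^k]=-G(X^k)$ to find $\Delta Z^k\in\mathbb{R}^{n\times n}$ such that (a) $\|(\mathrm{D}G(X^k)\circ(\mathrm{D}G(X^k))^*+\overline\sigma_k\,\mathrm{id})[\Delta Z^k]+G(X^k)\|_F\le\overline\eta_k\|G(X^k)\|_F$, and (b) $\|\mathrm{D}G(X^k)\circ(\mathrm{D}G(X^k))^*[\Delta Z^k]+G(X^k)\|_F\le\widehat\eta_{\max}\|G(X^k)\|_F$. Set $\widehat{\Delta X}^k=(\mathrm{D}G(X^k))^*[\Delta Z^k]$ and $\widehat\eta_k=\|\mathrm{D}G(X^k)[\widehat{\Delta X}^k]+G(X^k)\|_F/\|G(X^k)\|_F$. Step 2: set $\eta_k=\widehat\eta_k$, $\Delta X^k=\widehat{\Delta X}^k$. Repeat-loop: until $\|G(R_{X^k}(\Delta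 X^k))\|_F\le(1-t(1-\eta_k))\|G(X^k)\|_F$ holds, choose $\theta\in[\theta_{\min},\theta_{\max}]$ (possibly different each time) and replace $\Delta X^k$ by $\theta\Delta X^k$ and $\eta_k$ by $1-\theta(1-\eta_k)$. Then set $X^{k+1}=R_{X^k}(\Delta X^k)$. Step 3: replace $k$ by $k+1$ and go to Step 1. A sequence $\{X^k\}$ is generated by the method if for every $k\ge0$ Step 1 produces such a $\Delta Z^k$, the repeat-loop terminates, and $X^{k+1}=R_{X^k}(\Delta X^k)$ with $\Delta X^k$ the final value at termination of the repeat-loop; in particular $G(X^k)\ne\mathbf{0}_{n\times n}$ for all $k$, so that $\widehat\eta_k$ is defined. *)

(* Defs.v *)
From HB Require Import structures.
From mathcomp Require Import all_boot all_order all_algebra.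
From mathcomp Require Export complex.
From mathcomp Require Import all_classical all_reals all_analysis.
Set Implicit Arguments.
Unset Strict Implicit.
Unset Printing Implicit Defensive.
Import Order.TTheory GRing.Theory Num.Theory.
Import numFieldNormedType.Exports.
Local Open Scope classical_set_scope.
Local Open Scope ring_scope.

(* Indices are 0-based: the pair written (lambda_{2k+1}, lambda_{2k+2}) on
   paper sits at the indices (2k, 2k+1), for k < s. The list is then
   automatically closed under conjugation. *)
Definition conjugate_ordered (R : realType) (n : nat) (s : nat)
    (lam : 'I_n -> R[i]) : Prop :=
  [/\ (s.*2 <= n)%N,
      forall (k : nat) (i j : 'I_n), (k < s)%N ->
        i = k.*2 :> nat -> j = k.*2.+1 :> nat ->
        exists a b : R,
          [/\ b != 0, lam i = (a +i* b)%C & lam j = (a -i* b)%C]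
    & forall i : 'I_n, (s.*2 <= i)%N -> complex.Im (lam i) = 0].

(* Rows and columns 2k, 2k+1 (k < s) carry the block [a b; -b a]: the
   off-diagonal entry in row i is Im (lam i), which is b in row 2k and -b in
   row 2k+1. *)
Definition blkdiag_spectrum (R : realType) (n : nat) (s : nat)
    (lam : 'I_n -> R[i]) : 'M[R]_n :=
  \matrix_(i, j)
    if i == j then complex.Re (lam i)
    else if (i < s.*2)%N && (i./2 == j./2)%N then complex.Im (lam i)
    else 0.

Definition frob_dot (R : realType) (n : nat) (A B : 'M[R]_n) : R :=
  \tr (A^T *m B).

Definition frob_norm (R : realType) (n : nat) (A : 'M[R]_n) : R :=
  Num.sqrt (frob_dot A A).

Notation triple R n := ('M[R]_n * 'M[R]_n * 'M[R]_n)%type.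

Section Geometry.
Variables (R : realType) (n : nat) (Lam : 'M[R]_n).

Definition fixed_index (i j : 'I_n) : bool := (j <= i)%N || (Lam i j != 0).

Definition Vspace : set 'M[R]_n :=
  [set V | forall i j, fixed_index i j -> V i j = 0].

Definition orthogonal_group : set 'M[R]_n := [set Q | Q^T *m Q = 1%:M].

Definition domain : set (triple R n) :=
  [set X | orthogonal_group X.1.2 /\ Vspace X.2].

Definition tangent (X : triple R n) : set (triple R n) :=
  [set xi | (exists Om : 'M[R]_n, Om^T = - Om /\ xi.1.2 = X.1.2 *m Om)
            /\ Vspace xi.2].

Definition metric (xi zeta : triple R n) : R :=
  frob_dot xi.1.1 zeta.1.1 + frob_dot xi.1.2 zeta.1.2
  + frob_dot xi.2 zeta.2.

Definition G (X : triple R n) : 'M[R]_n :=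
  map2_mx *%R X.1.1 X.1.1 - X.1.2 *m (Lam + X.2) *m X.1.2^T.

(* The formula for G makes sense on the whole ambient space of triples, and
   the manifold is embedded there, so that its differential at X is the
   restriction of the ambient one to tangent X. DG X is only ever applied to
   tangent vectors below. *)
Definition DG (X xi : triple R n) : 'M[R]_n := 'd G X xi.

(* The value at Z of the adjoint of DG X : tangent X -> 'M_n is the unique
   tangent vector representing the linear form zeta |-> <DG X zeta, Z>. *)
Definition DG_adj (X : triple R n) (Z : 'M[R]_n) : triple R n :=
  xget 0 [set xi | tangent X xi /\
    forall zeta, tangent X zeta -> frob_dot (DG X zeta) Z = metric zeta xi].

Definition is_qf (A Q : 'M[R]_n) : Prop :=
  orthogonal_group Q /\
  exists T : 'M[R]_n,
    [/\ A = Q *m T, forall i j : 'I_n, (j < i)%N -> T i j = 0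
      & forall i, 0 < T i i].

(* The default value 1%:M is only taken when A is singular, which never
   happens for A = Q + zeta with zeta tangent at Q. *)
Definition qf (A : 'M[R]_n) : 'M[R]_n := xget 1%:M [set Q | is_qf A Q].

Definition retraction (X xi : triple R n) : triple R n :=
  (X.1.1 + xi.1.1, qf (X.1.2 + xi.1.2), X.2 + xi.2).

End Geometry.

(* cg_state A B Z0 Z r p: from the starting point Z0, the conjugate gradient
   method for A[Z] = B reaches the iterate Z, with residual r and search
   direction p. *)
Inductive cg_state (R : realType) (n : nat) (A : 'M[R]_n -> 'M[R]_n)
    (B Z0 : 'M[R]_n) : 'M[R]_n -> 'M[R]_n -> 'M[R]_n -> Prop :=
| cg_init : cg_state A B Z0 Z0 (B - A Z0) (B - A Z0)
| cg_next (Z r p : 'M[R]_n) :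
    cg_state A B Z0 Z r p -> r != 0 -> frob_dot p (A p) != 0 ->
    let alpha := frob_dot r r / frob_dot p (A p) in
    let r' := r - alpha *: A p in
    let beta := frob_dot r' r' / frob_dot r r in
    cg_state A B Z0 (Z + alpha *: p) r' (r' + beta *: p).

Section Method.
Variables (R : realType) (n : nat) (Lam : 'M[R]_n).
Variables (sigma_max eta_max etahat_max t theta_min theta_max : R).

Definition normal_op (X : triple R n) (Z : 'M[R]_n) : 'M[R]_n :=
  DG Lam X (DG_adj Lam X Z).

Definition sigma_bar (X : triple R n) : R :=
  Num.min sigma_max (frob_norm (G Lam X)).

Definition eta_bar (X : triple R n) : R :=
  Num.min eta_max (frob_norm (G Lam X)).

Definition regularized_op (X : triple R n) (Z : 'M[R]_n) : 'M[R]_n :=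
  normal_op X Z + sigma_bar X *: Z.

(* The method does not prescribe the starting point Z0 of the conjugate
   gradient iteration. *)
Definition inexact_solution (X : triple R n) (dZ : 'M[R]_n) : Prop :=
  [/\ exists Z0 r p, cg_state (regularized_op X) (- G Lam X) Z0 dZ r p,
      frob_norm (regularized_op X dZ + G Lam X)
        <= eta_bar X * frob_norm (G Lam X)
    & frob_norm (normal_op X dZ + G Lam X)
        <= etahat_max * frob_norm (G Lam X)].

Definition eta_hat (X dX : triple R n) : R :=
  frob_norm (DG Lam X dX + G Lam X) / frob_norm (G Lam X).

Definition sufficient_decrease (X dX : triple R n) (eta : R) : Prop :=
  frob_norm (G Lam (retraction X dX))
    <= (1 - t * (1 - eta)) * frob_norm (G Lam X).

(* backtrack X dX eta dX': the repeat-loop entered at X with the values dX and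
   eta terminates with the value dX' of the step. *)
Inductive backtrack (X : triple R n) :
    triple R n -> R -> triple R n -> Prop :=
| backtrack_stop dX eta :
    sufficient_decrease X dX eta -> backtrack X dX eta dX
| backtrack_shrink dX eta theta dX' :
    ~ sufficient_decrease X dX eta -> theta_min <= theta <= theta_max ->
    backtrack X (theta *: dX) (1 - theta * (1 - eta)) dX' ->
    backtrack X dX eta dX'.

Definition newton_cg_step (X X' : triple R n) : Prop :=
  exists dZ, inexact_solution X dZ /\
    let dXhat := DG_adj Lam X dZ in
    exists dX, backtrack X dXhat (eta_hat X dXhat) dX /\
      X' = retraction X dX.

Definition generated_by_newton_cg (X : nat -> triple R n) : Prop :=
  [/\ domain Lam (X 0%N), forall k, G Lam (X k) != 0
    & forall k, newton_cg_step (X k) (X k.+1)].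

End Method.

(* Main.v *)
From HB Require Import structures.
Require Import Defs.
From mathcomp Require Import all_boot all_order all_algebra.
From mathcomp Require Import all_classical all_reals all_analysis.
From mathcomp Require Import ring lra.
Set Implicit Arguments.
Unset Strict Implicit.
Unset Printing Implicit Defensive.
Import Order.TTheory GRing.Theory Num.Theory.
Import numFieldNormedType.Exports.
Local Open Scope classical_set_scope.
Local Open Scope ring_scope.

(** The method only ever decreases |G(X^k)|, so everything is a matter of what
    happens near Xbar. Surjectivity of DG(Xbar) persists nearby, quantitatively:
    |DG(X)^* Z| <= C |DG(X) DG(X)^* Z|. Hence the initial step satisfies
    |dX| <= Gamma (1 - eta) |G(X)|, an inequality that backtracking preserves
    together with |DG(X) dX + G(X)| <= eta |G(X)|. As the retraction is
    first order with a uniform quadratic error, steps with |dX| below a fixed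
    delta are accepted, which keeps 1 - eta away from 0. So near Xbar, |G|
    decreases by a fixed factor and the length of a step is at most a constant
    times the decrease of |G|: the steps telescope, the iterates starting close
    enough to Xbar never leave a given ball, and |G(X^k)| tends to 0. *)

(** * Frobenius norm *)

(** The defect is a sum of squares up to a factor: [B * (A * B - C ^+ 2)] equals the sum of
    [(B * a i - C * b i) ^+ 2]. If [B = 0], every [b i] vanishes and so does [C]. *)
Lemma sum_cauchy_schwarz (R : realFieldType) (I : finType) (a b : I -> R) :
  (\sum_i a i * b i) ^+ 2 <= (\sum_i a i ^+ 2) * (\sum_i b i ^+ 2).
Proof.
set A := \sum_i a i ^+ 2; set B := \sum_i b i ^+ 2; set C := \sum_i _.
have B_ge0 : 0 <= B by apply: sumr_ge0 => i _; exact: sqr_ge0.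
have key : 0 <= B * (A * B - C ^+ 2).
  have -> : B * (A * B - C ^+ 2) = \sum_i (B * a i - C * b i) ^+ 2.
    rewrite (eq_bigr (fun i => B ^+ 2 * a i ^+ 2 +
      (- (2 * B * C) * (a i * b i) + C ^+ 2 * b i ^+ 2))); last by move=> i _; ring.
    by rewrite !big_split /= -!mulr_sumr -/A -/B -/C; ring.
  by apply: sumr_ge0 => i _; exact: sqr_ge0.
have [B0|B_neq0] := eqVneq B 0; last first.
  by rewrite -subr_ge0 -(pmulr_rge0 _ (_ : 0 < B)) // lt0r B_neq0.
have b0 i : b i = 0.
  apply/eqP; rewrite -sqrf_eq0; apply/eqP.
  by apply: (psumr_eq0P _ B0) => // j _; exact: sqr_ge0.
by rewrite /C big1 ?expr0n ?B0 ?mulr0 // => i _; rewrite b0 mulr0.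
Qed.

Section Frobenius.
Variables (R : realType) (n : nat).
Implicit Types (A B C Q : 'M[R]_n) (a : R).

Lemma frob_dotE A B :
  frob_dot A B = \sum_(p : 'I_n * 'I_n) A p.1 p.2 * B p.1 p.2.
Proof.
rewrite /frob_dot /mxtrace -(pair_bigA _ (fun i j => A i j * B i j)) exchange_big.
by apply: eq_bigr => i _ /=; rewrite mxE; apply: eq_bigr => j _; rewrite mxE.
Qed.

Lemma frob_dotC A B : frob_dot A B = frob_dot B A.
Proof. by rewrite !frob_dotE; apply: eq_bigr => p _; rewrite mulrC. Qed.

Lemma frob_dotDl A B C : frob_dot (A + B) C = frob_dot A C + frob_dot B C.
Proof. by rewrite /frob_dot linearD /= mulmxDl mxtraceD. Qed.

Lemma frob_dotDr A B C : frob_dot C (A + B) = frob_dot C A + frob_dot C B.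
Proof. by rewrite !(frob_dotC C) frob_dotDl. Qed.

Lemma frob_dotZl a A B : frob_dot (a *: A) B = a * frob_dot A B.
Proof. by rewrite /frob_dot linearZ /= -scalemxAl mxtraceZ. Qed.

Lemma frob_dotZr a A B : frob_dot A (a *: B) = a * frob_dot A B.
Proof. by rewrite !(frob_dotC A) frob_dotZl. Qed.

Lemma frob_dotNl A B : frob_dot (- A) B = - frob_dot A B.
Proof. by rewrite -scaleN1r frob_dotZl mulN1r. Qed.

Lemma frob_dotNr A B : frob_dot A (- B) = - frob_dot A B.
Proof. by rewrite !(frob_dotC A) frob_dotNl. Qed.

Lemma frob_dotBl A B C : frob_dot (A - B) C = frob_dot A C - frob_dot B C.
Proof. by rewrite frob_dotDl frob_dotNl. Qed.

Lemma frob_dot_ge0 A : 0 <= frob_dot A A.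
Proof. by rewrite frob_dotE; apply: sumr_ge0 => p _; rewrite -expr2 sqr_ge0. Qed.

Lemma frob_norm_ge0 A : 0 <= frob_norm A.
Proof. exact: sqrtr_ge0. Qed.

Lemma frob_norm_sqr A : frob_norm A ^+ 2 = frob_dot A A.
Proof. by rewrite sqr_sqrtr // frob_dot_ge0. Qed.

Lemma frob_norm_le A a : 0 <= a -> (frob_norm A <= a) = (frob_dot A A <= a ^+ 2).
Proof.
by move=> a_ge0; rewrite -frob_norm_sqr ler_pXn2r // nnegrE // frob_norm_ge0.
Qed.

Lemma frob_cauchy_schwarz A B : frob_dot A B <= frob_norm A * frob_norm B.
Proof.
apply: le_trans (ler_norm _) _.
have h : 0 <= frob_norm A * frob_norm B by rewrite mulr_ge0 ?frob_norm_ge0.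
rewrite -[leRHS]ger0_norm // -ler_sqr ?nnegrE // !(real_normK (num_real _)).
rewrite exprMn !frob_norm_sqr !frob_dotE.
under [X in _ <= X * _]eq_bigr => p _ do rewrite -expr2.
under [X in _ <= _ * X]eq_bigr => p _ do rewrite -expr2.
exact: sum_cauchy_schwarz.
Qed.

Lemma frob_normD A B : frob_norm (A + B) <= frob_norm A + frob_norm B.
Proof.
rewrite frob_norm_le ?addr_ge0 ?frob_norm_ge0 //.
rewrite frob_dotDl !frob_dotDr (frob_dotC B A) sqrrD !frob_norm_sqr.
by have := frob_cauchy_schwarz A B; lra.
Qed.

Lemma frob_normZ a A : frob_norm (a *: A) = `|a| * frob_norm A.
Proof.
by rewrite /frob_norm frob_dotZl frob_dotZr mulrA -expr2 sqrtrM ?sqr_ge0 // sqrtr_sqr.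
Qed.

Lemma frob_normN A : frob_norm (- A) = frob_norm A.
Proof. by rewrite -scaleN1r frob_normZ normrN1 mul1r. Qed.

Lemma frob_normB A B : frob_norm (A - B) <= frob_norm A + frob_norm B.
Proof. by rewrite -(frob_normN B) frob_normD. Qed.

Lemma frob_distC A B : frob_norm (A - B) = frob_norm (B - A).
Proof. by rewrite -frob_normN opprB. Qed.

Lemma frob_norm0 : frob_norm (0 : 'M[R]_n) = 0.
Proof. by rewrite -(scale0r 0) frob_normZ normr0 mul0r. Qed.

Lemma frob_norm_sum (I : finType) (F : I -> 'M[R]_n) :
  frob_norm (\sum_i F i) <= \sum_i frob_norm (F i).
Proof.
elim/big_rec2: _ => [|i x y _ le_xy]; first by rewrite frob_norm0.
by apply: le_trans (frob_normD _ _) _; rewrite lerD2l.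
Qed.

Lemma frob_norm_tr A : frob_norm A^T = frob_norm A.
Proof. by rewrite /frob_norm /frob_dot trmxK mxtrace_mulC. Qed.

Lemma frob_norm_entry A i j : `|A i j| <= frob_norm A.
Proof.
rewrite -ler_sqr ?nnegrE ?frob_norm_ge0 // frob_norm_sqr frob_dotE (real_normK (num_real _)).
by rewrite (bigD1 (i, j)) //= -expr2 lerDl sumr_ge0 // => p _; rewrite -expr2 sqr_ge0.
Qed.

Lemma frob_norm_eq0 A : frob_norm A = 0 -> A = 0.
Proof.
move=> A0; apply/matrixP => i j; apply/eqP.
by rewrite mxE -normr_le0 -A0 frob_norm_entry.
Qed.

Lemma frob_normM A B : frob_norm (A *m B) <= frob_norm A * frob_norm B.
Proof.
rewrite frob_norm_le ?mulr_ge0 ?frob_norm_ge0 // exprMn !frob_norm_sqr.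
rewrite !frob_dotE -!(pair_bigA _ (fun i j => _ i j * _ i j)) /=.
rewrite [X in _ <= _ * X]exchange_big /= mulr_suml; apply: ler_sum => i _.
rewrite mulr_sumr; apply: ler_sum => j _; rewrite -expr2 mxE.
under [X in _ <= X * _]eq_bigr => p _ do rewrite -expr2.
under [X in _ <= _ * X]eq_bigr => p _ do rewrite -expr2.
exact: sum_cauchy_schwarz.
Qed.

Lemma frob_norm_hadamard A B :
  frob_norm (map2_mx *%R A B) <= frob_norm A * frob_norm B.
Proof.
rewrite frob_norm_le ?mulr_ge0 ?frob_norm_ge0 // exprMn (frob_norm_sqr B).
rewrite !frob_dotE mulr_sumr; apply: ler_sum => -[i j] _ /=; rewrite !mxE.
rewrite mulrACA -!expr2 ler_wpM2r ?sqr_ge0 //.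
by rewrite -(real_normK (num_real _)) ler_sqr ?nnegrE ?frob_norm_ge0 // frob_norm_entry.
Qed.

Lemma frob_norm_orthl Q A : Q^T *m Q = 1%:M -> frob_norm (Q *m A) = frob_norm A.
Proof.
by move=> QQ; rewrite /frob_norm /frob_dot trmx_mul mulmxA -(mulmxA A^T) QQ mulmx1.
Qed.

Lemma frob_norm_sqr1 : frob_norm (1%:M : 'M[R]_n) ^+ 2 = n%:R.
Proof. by rewrite frob_norm_sqr /frob_dot trmx1 mul1mx mxtrace1. Qed.

(** The norm that carries the topology on matrices is the largest absolute entry. With
    [frob_le_mx_norm], this bound makes the Frobenius norm equivalent to it. *)
Lemma mx_norm_le_frob A : `|A| <= frob_norm A.
Proof.
rewrite [leLHS]/Num.Def.normr /= mx_normrE; apply/bigmax_leP; split; first exact: frob_norm_ge0.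
by move=> p _; exact: frob_norm_entry.
Qed.

Lemma entry_le_mx_norm A i j : `|A i j| <= `|A|.
Proof.
by rewrite [leRHS]/Num.Def.normr /= mx_normrE; apply: (le_bigmax _ _ (i, j)).
Qed.

Lemma frob_le_mx_norm A : frob_norm A <= n%:R * `|A|.
Proof.
rewrite frob_norm_le ?mulr_ge0 ?ler0n // frob_dotE.
apply: (@le_trans _ _ (\sum_(p : 'I_n * 'I_n) `|A| ^+ 2)).
  apply: ler_sum => p _; rewrite -expr2 -(real_normK (num_real _)) ler_sqr ?nnegrE //.
  exact: entry_le_mx_norm.
by rewrite sumr_const card_prod card_ord -[leLHS]mulr_natl natrM exprMn expr2.
Qed.

End Frobenius.

(** * QR factorization near the orthogonal group *)

Lemma cV_sqnorm_gt0 (R : realType) n (v : 'cV[R]_n) :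
  v != 0 -> 0 < (v^T *m v) 0 0.
Proof.
move=> v_neq0; rewrite mxE; under eq_bigr do rewrite mxE -expr2.
rewrite lt0r sumr_ge0 ?andbT => [|i _]; last exact: sqr_ge0.
apply: contra_neq v_neq0 => s0; apply/colP => i; rewrite mxE; apply/eqP.
rewrite -sqrf_eq0; apply/eqP; apply: (psumr_eq0P _ s0) => // j _.
exact: sqr_ge0.
Qed.

(** Induction on the size: the Schur complement [C - a^-1 *: (b^T *m b)] of the top left entry is
    again symmetric positive definite. *)
Lemma cholesky (R : realType) n (M : 'M[R]_n) :
  M^T = M -> (forall v : 'cV_n, v != 0 -> 0 < (v^T *m (M *m v)) 0 0) ->
  exists T : 'M[R]_n, [/\ T^T *m T = M,
    forall i j : 'I_n, (j < i)%N -> T i j = 0 & forall i, 0 < T i i].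
Proof.
elim: n M => [|n IHn] M symM posM.
  by exists 0; split=> [|[]//|[]//]; apply/matrixP => -[].
rewrite -[n.+1]/(1 + n)%N in M symM posM *.
pose a : R := M (lshift n 0) (lshift n 0); pose b := ursubmx M; pose C := drsubmx M.
have defM : M = block_mx a%:M b b^T C.
  rewrite -[LHS]submxK; congr block_mx; last by rewrite trmx_ursub symM.
  by rewrite [LHS]mx11_scalar; congr _%:M; rewrite !mxE.
have symC : C^T = C by rewrite trmx_drsub symM.
have a_gt0 : 0 < a.
  have v_neq0 : delta_mx (lshift n 0) 0 != 0 :> 'cV[R]_(1 + n).
    by apply/eqP => /matrixP /(_ (lshift n 0) 0)/eqP; rewrite !mxE !eqxx oner_eq0.
  have := posM _ v_neq0.
  by rewrite -colE trmx_delta -rowE !mxE.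
have [T [defS upT posT]] : exists T : 'M[R]_n,
    [/\ T^T *m T = C - a^-1 *: (b^T *m b),
    forall i j : 'I_n, (j < i)%N -> T i j = 0 & forall i, 0 < T i i].
  apply: IHn => [|w w_neq0].
    by rewrite linearB /= linearZ /= trmx_mul trmxK symC.
  (* This first coordinate minimizes the quadratic form of [M] over the vectors [col_mx u w]; the
     minimum is the value of the Schur complement at [w]. *)
  pose u : 'M[R]_1 := - (a^-1 *: (b *m w)).
  have v_neq0 : col_mx u w != 0.
    by apply: contra_neq w_neq0 => /(congr1 dsubmx); rewrite col_mxKd linear0.
  have := posM _ v_neq0; rewrite defM mul_block_col tr_col_mx mul_row_col.
  rewrite mul_scalar_mx {1}/u scalerN.
  rewrite scalerA mulfV ?gt_eqF // scale1r addNr mulmx0 add0r.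
  by rewrite mulmxN -scalemxAr mulmxBl -scalemxAl mulmxA addrC.
pose r := Num.sqrt a.
have r_gt0 : 0 < r by rewrite sqrtr_gt0.
have r_neq0 : r != 0 by rewrite gt_eqF.
have rr : r * r = a by rewrite -expr2 sqr_sqrtr // ltW.
exists (block_mx r%:M (r^-1 *: b) 0 T); split.
- rewrite tr_block_mx mulmx_block defM trmx0 !mul0mx !mulmx0 !addr0.
  rewrite tr_scalar_mx -scalar_mxM rr defS mul_scalar_mx scalerA.
  rewrite mulfV // scale1r mul_mx_scalar [(_ *: b)^T]linearZ /= scalerA mulfV // scale1r.
  by rewrite -scalemxAl -scalemxAr scalerA -invfM rr addrC subrK.
- move=> i j; case: (split_ordP i) => i' ->; case: (split_ordP j) => j' ->.
  + by rewrite !ord1.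
  + by rewrite ord1.
  + by rewrite block_mxEdl mxE.
  + by rewrite block_mxEdr => lt_ji; apply: upT; rewrite -(ltn_add2l 1).
- move=> i; case: (split_ordP i) => i' ->; last by rewrite block_mxEdr.
  by rewrite block_mxEul ord1 mxE eqxx.
Qed.

(** If [T] is the Cholesky factor of [A^T *m A], then [A *m invmx T] is orthogonal. *)
Lemma is_qf_exists (R : realType) n (A : 'M[R]_n) :
  A \in unitmx -> exists P, is_qf A P.
Proof.
move=> uA; have [|v v_neq0|T [defT upT posT]] := @cholesky _ _ (A^T *m A).
- by rewrite trmx_mul trmxK.
- rewrite -mulmxA mulmxA -trmx_mul; apply: cV_sqnorm_gt0.
  by apply: contra_neq v_neq0 => Av0; rewrite -(mulKmx uA v) Av0 mulmx0.
have uT : T \in unitmx.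
  have : T^T *m T \in unitmx by rewrite defT unitmx_mul unitmx_tr uA.
  by rewrite unitmx_mul => /andP[].
exists (A *m invmx T); split; last by exists T; rewrite mulmxKV.
rewrite /orthogonal_group /= trmx_mul mulmxA -(mulmxA _ A^T) -defT trmx_inv.
by rewrite mulmxA mulVmx ?unitmx_tr // mul1mx mulmxV.
Qed.

(** * Error of the QR factor at a tangent step *)

Section Retraction.
Variables (R : realType) (n : nat).
Implicit Types (A B Q P T U Om : 'M[R]_n).

Lemma frob_dot_skew A Om : Om^T = - Om -> frob_dot A (A *m Om) = 0.
Proof.
move=> skew; have : frob_dot A (A *m Om) = - frob_dot A (A *m Om); last by lra.
rewrite {1}/frob_dot -mxtrace_tr trmx_mul trmxK trmx_mul skew mulNmx mulNmx.
by rewrite linearN /= -mulmxA mxtrace_mulC -mulmxA.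
Qed.

(** If [K *m (1%:M + Om) = 0], pairing with [K] leaves only the squared norm of [K], since [K *m Om]
    is orthogonal to [K] by skewness. Hence [K = 0]. *)
Lemma unitmx_add_skew Q Om :
  Q^T *m Q = 1%:M -> Om^T = - Om -> Q + Q *m Om \in unitmx.
Proof.
move=> QQ skew; rewrite -{1}[Q]mulmx1 -mulmxDr unitmx_mul.
rewrite (mulmx1_unit QQ).2 /= -row_free_unit -kermx_eq0; apply/eqP.
set K := kermx _; have : K *m (1%:M + Om) = 0 by exact: mulmx_ker.
rewrite mulmxDr mulmx1 => K0; apply: frob_norm_eq0; apply/eqP.
have : frob_dot K (K + K *m Om) = 0 by rewrite K0 /frob_dot mulmx0 mxtrace0.
by rewrite frob_dotDr frob_dot_skew // addr0 -frob_norm_sqr => /eqP; rewrite sqrf_eq0.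
Qed.

(** Let [B] solve [T *m B = delta_mx i i]. Back substitution gives [T i i * B i i = 1], and
    expansiveness bounds the norm of [B] by that of [delta_mx i i], so [B i i <= 1]. *)
Lemma expansive_triangular_diag T i : T \in unitmx ->
  (forall i j : 'I_n, (j < i)%N -> T i j = 0) -> (forall i, 0 < T i i) ->
  (forall B, frob_dot B B <= frob_dot (T *m B) (T *m B)) -> 1 <= T i i.
Proof.
move=> uT upT posT expT.
have [B TB] : exists B, T *m B = delta_mx i i.
  by exists (invmx T *m delta_mx i i); rewrite mulKVmx.
have TBE (j : 'I_n) : (forall k : 'I_n, (j < k)%N -> B k i = 0) ->
    T j j * B j i = (j == i)%:R.
  move=> Bk; have /matrixP /(_ j i) := TB; rewrite !mxE eqxx andbT => <-.
  rewrite (bigD1 j) //= big1 ?addr0 // => k; rewrite neq_ltn => /orP[kj|jk].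
    by rewrite upT ?mul0r.
  by rewrite Bk ?mulr0.
(* Back substitution from the last row upwards, as an induction on a bound [m] for [n - j]; the case
   [m = 0] is void because [j < n]. *)
have B0 m : forall j : 'I_n, (n - j <= m)%N -> (i < j)%N -> B j i = 0.
  elim: m => [|m IHm] j; first by rewrite leqn0 subn_eq0 leqNgt ltn_ord.
  move=> njm ij; have Bk (k : 'I_n) : (j < k)%N -> B k i = 0.
    move=> jk; apply: IHm; last exact: ltn_trans jk.
    by rewrite -ltnS (leq_trans _ njm) // ltn_sub2l.
  have /eqP := TBE j Bk.
  by rewrite (negPf (_ : j != i)) ?neq_ltn ?ij ?orbT // mulf_eq0 gt_eqF //= => /eqP.
have TBi : T i i * B i i = 1.
  by rewrite TBE ?eqxx // => k; exact: (B0 n) (leq_subr _ _).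
have Bii : B i i <= 1.
  apply: le_trans (ler_norm _) _; apply: le_trans (frob_norm_entry B i i) _.
  rewrite frob_norm_le // expr1n; apply: le_trans (expT B) _; rewrite TB.
  rewrite /frob_dot trmx_delta mul_delta_mx.
  by rewrite /mxtrace (bigD1 i) //= big1 => [|j /negPf ji]; rewrite mxE ?eqxx ?ji ?addr0.
by rewrite -TBi ler_piMr // ltW.
Qed.

(** Expanding the square on the right gives twice the squared norm of [U] plus twice the product of
    [U] with [U^T]. That product is the sum of the squared diagonal entries. *)
Lemma upper_triangular_sym_norm U :
  (forall i j : 'I_n, (j < i)%N -> U i j = 0) -> frob_norm U <= frob_norm (U + U^T).
Proof.
move=> upU; rewrite frob_norm_le ?frob_norm_ge0 // frob_norm_sqr.
have tr_ge0 : 0 <= frob_dot U U^T.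
  rewrite frob_dotE; apply: sumr_ge0 => -[i j] _ /=; rewrite mxE.
  have [ij|ji|/val_inj ->] := ltngtP i j; last by rewrite -expr2 sqr_ge0.
    by rewrite [U j i]upU // mulr0.
  by rewrite upU // mul0r.
rewrite frob_dotDl !frob_dotDr (frob_dotC U^T U) -!frob_norm_sqr frob_norm_tr.
by have := sqr_ge0 (frob_norm U); lra.
Qed.

(* The triangular factor T satisfies T^T T = I + Om^T Om >= I, so its diagonal
   is at least 1 and U = T - I has |U|^2 <= |Om|^2 by taking traces; the
   identity U + U^T = Om^T Om - U^T U then improves this to a quadratic bound. *)
Lemma is_qf_tangent Q Om P :
  Q^T *m Q = 1%:M -> Om^T = - Om -> is_qf (Q + Q *m Om) P ->
  frob_norm (P - (Q + Q *m Om)) <= frob_norm Om /\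
  frob_norm (P - (Q + Q *m Om)) <= 2 * frob_norm Om ^+ 2.
Proof.
move=> QQ skew [PP [T [defA upT posT]]]; have uA := unitmx_add_skew QQ skew.
have TT : T^T *m T = 1%:M + Om^T *m Om.
  have : (Q + Q *m Om)^T *m (Q + Q *m Om) = T^T *m T.
    by rewrite defA trmx_mul mulmxA -(mulmxA _ P^T) PP mulmx1.
  move=> <-; rewrite [(_ + _)^T]linearD /= trmx_mul mulmxDl !mulmxDr -!(mulmxA _ Q^T) !(mulmxA Q^T) QQ.
  by rewrite !mul1mx !mulmx1 skew addrA addrK.
have uT : T \in unitmx by move: uA; rewrite defA unitmx_mul => /andP[].
have T_norm B : frob_dot (T *m B) (T *m B) = frob_dot B B + frob_dot (Om *m B) (Om *m B).
  rewrite /frob_dot !trmx_mul mulmxA -(mulmxA B^T) TT mulmxDr mulmx1 mulmxDl.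
  by rewrite mxtraceD !mulmxA.
have diagT i : 1 <= T i i.
  by apply: expansive_triangular_diag => // B; rewrite T_norm lerDl frob_dot_ge0.
pose U := T - 1%:M; have T_U : T = 1%:M + U by rewrite addrC subrK.
have trT : n%:R <= \tr T.
  rewrite -[n in n%:R]card_ord -sum1_card natr_sum; exact: ler_sum.
(* The squared norm of [T - 1%:M] is that of [T], namely [n%:R + frob_norm Om ^+ 2], minus
   [2 * \tr T], plus [n%:R]; now use [trT]. *)
have normU : frob_norm U ^+ 2 <= frob_norm Om ^+ 2.
  have := T_norm 1%:M; rewrite !mulmx1 -!frob_norm_sqr frob_norm_sqr1 => nT.
  have T1 : frob_dot T 1%:M = \tr T by rewrite frob_dotC /frob_dot trmx1 mul1mx.
  rewrite /U frob_norm_sqr frob_dotBl !(frob_dotC _ (T - _)) !frob_dotBl.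
  by rewrite (frob_dotC 1%:M T) T1 -!frob_norm_sqr frob_norm_sqr1 nT; lra.
have -> : frob_norm (P - (Q + Q *m Om)) = frob_norm U.
  rewrite defA {1}T_U mulmxDr mulmx1 opprD addrA subrr add0r frob_normN.
  exact: frob_norm_orthl.
split; first by rewrite -ler_sqr ?nnegrE ?frob_norm_ge0.
have upU (i j : 'I_n) : (j < i)%N -> U i j = 0.
  by move=> ji; rewrite !mxE upT // -val_eqE /= gtn_eqF // subr0.
have UU : U + U^T = Om^T *m Om - U^T *m U.
  apply/eqP; rewrite eq_sym subr_eq; apply/eqP/(addrI 1%:M); rewrite -TT T_U.
  rewrite [(_ + _)^T]linearD /= trmx1 mulmxDl !mulmxDr !mul1mx mulmx1 !addrA.
  by congr (_ + _); rewrite -!addrA.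
apply: le_trans (upper_triangular_sym_norm upU) _; rewrite UU.
apply: le_trans (frob_normB _ _) _.
have := frob_normM Om^T Om; have := frob_normM U^T U.
by rewrite !frob_norm_tr -!expr2; lra.
Qed.

End Retraction.

(** * Differential of G *)

Section TripleNorm.
Variables (R : realType) (n : nat).
Implicit Types (X Y xi zeta : triple R n) (a : R).

(** A sum of norms is used instead of the norm induced by [metric], so that estimates split into
    components. The two are equivalent ([metric_le], [triple_norm_sqr_le]), as are this norm and the
    one of the topology. *)
Definition triple_norm xi : R :=
  frob_norm xi.1.1 + frob_norm xi.1.2 + frob_norm xi.2.

Lemma triple_norm_ge0 xi : 0 <= triple_norm xi.
Proof. by rewrite !addr_ge0 ?frob_norm_ge0. Qed.

Lemma triple_normD X Y : triple_norm (X + Y) <= triple_norm X + triple_norm Y.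
Proof.
have := frob_normD X.1.1 Y.1.1; have := frob_normD X.1.2 Y.1.2.
have := frob_normD X.2 Y.2; rewrite /triple_norm /=; lra.
Qed.

Lemma triple_normZ a X : triple_norm (a *: X) = `|a| * triple_norm X.
Proof. by rewrite /triple_norm /= !frob_normZ !mulrDr. Qed.

Lemma triple_norm_sum (I : finType) (F : I -> triple R n) :
  triple_norm (\sum_i F i) <= \sum_i triple_norm (F i).
Proof.
elim/big_rec2: _ => [|i x y _ le_xy]; last first.
  by apply: le_trans (triple_normD _ _) _; rewrite lerD2l.
by rewrite /triple_norm /= !frob_norm0 !addr0.
Qed.

Lemma norm_le_triple_norm X : `|X| <= triple_norm X.
Proof.
rewrite !prod_normE /= !ge_max.
have := mx_norm_le_frob X.1.1; have := mx_norm_le_frob X.1.2; have := mx_norm_le_frob X.2.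
have := frob_norm_ge0 X.1.1; have := frob_norm_ge0 X.1.2; have := frob_norm_ge0 X.2.
by rewrite /triple_norm; move=> *; apply/andP; split; [apply/andP; split|]; lra.
Qed.

Lemma triple_norm_le_norm X : triple_norm X <= 3 * n%:R * `|X|.
Proof.
have le11 : `|X.1.1| <= `|X| by rewrite !prod_normE /= !le_max lexx.
have le12 : `|X.1.2| <= `|X| by rewrite !prod_normE /= !le_max lexx orbT.
have le2 : `|X.2| <= `|X| by rewrite prod_normE le_max lexx orbT.
have h (A : 'M[R]_n) : `|A| <= `|X| -> frob_norm A <= n%:R * `|X|.
  by move=> leA; apply: le_trans (frob_le_mx_norm A) _; rewrite ler_wpM2l ?ler0n.
by have := h _ le11; have := h _ le12; have := h _ le2; rewrite /triple_norm; lra.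
Qed.

Lemma metric_le xi zeta : metric xi zeta <= triple_norm xi * triple_norm zeta.
Proof.
have := frob_cauchy_schwarz xi.1.1 zeta.1.1.
have := frob_cauchy_schwarz xi.1.2 zeta.1.2.
have := frob_cauchy_schwarz xi.2 zeta.2.
rewrite /metric /triple_norm.
move: (frob_norm_ge0 xi.1.1) (frob_norm_ge0 xi.1.2) (frob_norm_ge0 xi.2).
move: (frob_norm_ge0 zeta.1.1) (frob_norm_ge0 zeta.1.2) (frob_norm_ge0 zeta.2).
move: (frob_norm _) (frob_norm _) (frob_norm _) (frob_norm _) (frob_norm _) (frob_norm _).
by move=> *; nra.
Qed.

Lemma triple_norm_sqr_le xi : triple_norm xi ^+ 2 <= 3 * metric xi xi.
Proof.
rewrite /metric -!frob_norm_sqr /triple_norm.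
move: (frob_norm _) (frob_norm _) (frob_norm _) => a b c.
have := sqr_ge0 (a - b); have := sqr_ge0 (a - c); have := sqr_ge0 (b - c); nra.
Qed.

End TripleNorm.

Section Differential.
Variables (R : realType) (n : nat) (Lam : 'M[R]_n).
Implicit Types (X xi zeta : triple R n).

Definition dG X xi : 'M[R]_n :=
  2 *: map2_mx *%R X.1.1 xi.1.1
  - (xi.1.2 *m (Lam + X.2) *m X.1.2^T + X.1.2 *m xi.2 *m X.1.2^T
     + X.1.2 *m (Lam + X.2) *m xi.1.2^T).

Definition G_remainder X xi : 'M[R]_n :=
  map2_mx *%R xi.1.1 xi.1.1
  - (xi.1.2 *m (Lam + X.2) *m xi.1.2^T + X.1.2 *m xi.2 *m xi.1.2^T
     + xi.1.2 *m xi.2 *m X.1.2^T + xi.1.2 *m xi.2 *m xi.1.2^T).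

(** [G] is a polynomial of degree 3 in the triple, so the expansion is exact: [dG] gathers the terms
    linear in [xi], [G_remainder] those of degree 2 and 3. *)
Lemma G_expansion X xi : G Lam (X + xi) = G Lam X + dG X xi + G_remainder X xi.
Proof.
case: X => [[S Q] V]; case: xi => [[A Z] E]; rewrite /G /dG /G_remainder /=.
rewrite addrA [(Q + Z)^T]linearD /= !mulmxDl !mulmxDr !mulmxDl.
move: (Q *m Lam *m Q^T) (Q *m Lam *m Z^T) (Z *m Lam *m Q^T) (Z *m Lam *m Z^T)
  (Q *m V *m Q^T) (Q *m V *m Z^T) (Z *m V *m Q^T) (Z *m V *m Z^T)
  (Q *m E *m Q^T) (Q *m E *m Z^T) (Z *m E *m Q^T) (Z *m E *m Z^T) => *.
by apply/matrixP => i j; rewrite !mxE; ring.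
Qed.

Lemma dG_is_linear X : linear (dG X).
Proof.
case: X => [[S Q] V] a [[A1 Z1] E1] [[A2 Z2] E2]; rewrite /dG /=.
rewrite [(a *: Z1 + Z2)^T]linearP /=.
rewrite !mulmxDr !mulmxDl -!scalemxAr -!scalemxAl.
move: (Z1 *m Lam *m Q^T) (Z2 *m Lam *m Q^T) (Z1 *m V *m Q^T) (Z2 *m V *m Q^T)
  (Q *m Lam *m Z1^T) (Q *m Lam *m Z2^T) (Q *m V *m Z1^T) (Q *m V *m Z2^T)
  (Q *m E1 *m Q^T) (Q *m E2 *m Q^T) => *.
by apply/matrixP => i j; rewrite !mxE; ring.
Qed.

HB.instance Definition _ X :=
  GRing.isLinear.Build R (triple R n) 'M[R]_n *:%R (dG X) (dG_is_linear X).

Lemma frob_normM3 (A B C : 'M[R]_n) :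
  frob_norm (A *m B *m C) <= frob_norm A * frob_norm B * frob_norm C.
Proof.
apply: le_trans (frob_normM _ _) _.
by rewrite ler_wpM2r ?frob_norm_ge0 ?frob_normM.
Qed.

Lemma dG_bound X xi K :
  frob_norm Lam + triple_norm X <= K -> frob_norm (dG X xi) <= (2 * K + 3 * K ^+ 2) * triple_norm xi.
Proof.
case: X => [[S Q] V]; case: xi => [[A Z] E]; rewrite /dG /triple_norm /=.
have := frob_norm_ge0 Lam.
have := frob_normD Lam V; move: (frob_norm_ge0 (Lam + V)); move: (Lam + V) => M.
have := frob_normM3 Z M Q^T; have := frob_normM3 Q E Q^T; have := frob_normM3 Q M Z^T.
move: (Z *m M *m Q^T) (Q *m E *m Q^T) (Q *m M *m Z^T) => B1 B2 B3.
rewrite !frob_norm_tr => b3 b2 b1.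
have := frob_norm_hadamard S A; move: (map2_mx _ S A) => B0 b0.
have := frob_normB (2 *: B0) (B1 + B2 + B3); have := frob_normD (B1 + B2) B3.
have := frob_normD B1 B2; rewrite frob_normZ ger0_norm //.
move: b0 b1 b2 b3.
move: (frob_norm_ge0 S) (frob_norm_ge0 Q) (frob_norm_ge0 V).
move: (frob_norm_ge0 A) (frob_norm_ge0 Z) (frob_norm_ge0 E).
move: (frob_norm (2 *: B0 - _)) (frob_norm (B1 + B2 + B3)) (frob_norm (B1 + B2)).
move: (frob_norm B0) (frob_norm B1) (frob_norm B2) (frob_norm B3).
move: (frob_norm S) (frob_norm Q) (frob_norm V) (frob_norm A) (frob_norm Z) (frob_norm E).
move: (frob_norm Lam) (frob_norm M).
move=> l m s q v a z e b0 b1 b2 b3 N1 N2 N3 a0 z0 e0 s0 q0 v0 h0 h1 h2 h3 h4 h5 h6 m0 hm l0 hK.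
have qm : q * m <= K ^+ 2 by rewrite expr2 ler_pM //; lra.
have qq : q * q <= K ^+ 2 by rewrite expr2 ler_pM //; lra.
have sa : s * a <= K * a by rewrite ler_wpM2r //; lra.
have k0 : 0 <= K by lra.
have : z * m * q <= K ^+ 2 * z by rewrite (_ : z * m * q = q * m * z) ?ler_wpM2r //; ring.
have : q * m * z <= K ^+ 2 * z by rewrite ler_wpM2r //.
have : q * e * q <= K ^+ 2 * e by rewrite mulrAC ler_wpM2r.
have : 0 <= K ^+ 2 * z by rewrite mulr_ge0 ?sqr_ge0.
have : 0 <= K ^+ 2 * e by rewrite mulr_ge0 ?sqr_ge0.
have : 0 <= K ^+ 2 * a by rewrite mulr_ge0 ?sqr_ge0.
have : 0 <= K * z by rewrite mulr_ge0.
have : 0 <= K * e by rewrite mulr_ge0.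
by lra.
Qed.

(** In the bound [K], the 1 pays for the Hadamard square, [Lam] and [X] for the quadratic products,
    and [xi] itself for the cubic one. *)
Lemma G_remainder_bound X xi K :
  1 + frob_norm Lam + triple_norm X + triple_norm xi <= K ->
  frob_norm (G_remainder X xi) <= K * triple_norm xi ^+ 2.
Proof.
case: X => [[S Q] V]; case: xi => [[A Z] E]; rewrite /G_remainder /triple_norm /=.
have := frob_norm_ge0 Lam.
have := frob_normD Lam V; move: (frob_norm_ge0 (Lam + V)); move: (Lam + V) => M.
have := frob_normM3 Z M Z^T; have := frob_normM3 Q E Z^T.
have := frob_normM3 Z E Q^T; have := frob_normM3 Z E Z^T.
move: (Z *m M *m Z^T) (Q *m E *m Z^T) (Z *m E *m Q^T) (Z *m E *m Z^T) => B1 B2 B3 B4.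
rewrite !frob_norm_tr => b4 b3 b2 b1.
have := frob_norm_hadamard A A; move: (map2_mx _ A A) => B0 b0.
have := frob_normB B0 (B1 + B2 + B3 + B4); have := frob_normD (B1 + B2 + B3) B4.
have := frob_normD (B1 + B2) B3; have := frob_normD B1 B2.
move: b0 b1 b2 b3 b4.
move: (frob_norm_ge0 S) (frob_norm_ge0 Q) (frob_norm_ge0 V).
move: (frob_norm_ge0 A) (frob_norm_ge0 Z) (frob_norm_ge0 E).
move: (frob_norm (B0 - _)) (frob_norm (B1 + B2 + B3 + B4)).
move: (frob_norm (B1 + B2 + B3)) (frob_norm (B1 + B2)).
move: (frob_norm B0) (frob_norm B1) (frob_norm B2) (frob_norm B3) (frob_norm B4).
move: (frob_norm S) (frob_norm Q) (frob_norm V) (frob_norm A) (frob_norm Z) (frob_norm E).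
move: (frob_norm Lam) (frob_norm M).
move=> l m s q v a z e b0 b1 b2 b3 b4 N1 N2 N3 N4 a0 z0 e0 s0 q0 v0.
move=> h0 h1 h2 h3 h4 h5 h6 h7 h8 m0 hm l0 hK.
have za0 : 0 <= z * a by rewrite mulr_ge0.
have ze0 : 0 <= z * e by rewrite mulr_ge0.
have ae0 : 0 <= a * e by rewrite mulr_ge0.
have aa0 : 0 <= a * a by rewrite mulr_ge0.
have zz0 : 0 <= z * z by rewrite mulr_ge0.
have ee0 : 0 <= e * e by rewrite mulr_ge0.
have : z * m * z <= m * (a + z + e) ^+ 2.
  by rewrite (mulrC z m) -mulrA ler_wpM2l //; lra.
have : q * e * z + z * e * q <= q * (a + z + e) ^+ 2.
  have -> : q * e * z + z * e * q = q * (2 * (z * e)) by ring.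
  by rewrite ler_wpM2l //; lra.
have : z * e * z <= e * (a + z + e) ^+ 2.
  by rewrite (_ : z * e * z = e * (z * z)) ?ler_wpM2l //; [lra | ring].
have : (1 + m + q + e) * (a + z + e) ^+ 2 <= K * (a + z + e) ^+ 2.
  by rewrite ler_wpM2r ?sqr_ge0 //; lra.
by lra.
Qed.

Lemma DG_E X xi : DG Lam X xi = dG X xi.
Proof.
pose C : R := 3 * n%:R.
have C_ge0 : 0 <= C by rewrite mulr_ge0 ?ler0n.
rewrite /DG (@diff_unique R _ _ (G Lam) (dG X) X) //.
  apply: bounded_linear_continuous; apply/linear_boundedP.
  pose k := frob_norm Lam + triple_norm X; pose B := (2 * k + 3 * k ^+ 2) * C.
  near=> r => x; apply: le_trans (mx_norm_le_frob _) _.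
  apply: le_trans (dG_bound _ (lexx k)) _.
  apply: (@le_trans _ _ (B * `|x|)); last by rewrite ler_wpM2r //; near: r; exact: nbhs_pinfty_ge.
  have k_ge0 : 0 <= k by rewrite addr_ge0 ?frob_norm_ge0 ?triple_norm_ge0.
  rewrite /B -mulrA ler_wpM2l ?triple_norm_le_norm //.
  by rewrite addr_ge0 ?mulr_ge0 ?sqr_ge0.
apply/eqaddoP => _ /posnumP[e].
(* For [h] of norm at most 1, [C] bounds [triple_norm h], so [K] is valid for all such [h]. Below,
   [1 + C ^+ 2] replaces [C ^+ 2] to stay positive when [n = 0]. *)
pose K := 1 + frob_norm Lam + triple_norm X + C.
have K_gt0 : 0 < K by have := frob_norm_ge0 Lam; have := triple_norm_ge0 X; rewrite /K; lra.
have KC_gt0 : 0 < K * (1 + C ^+ 2).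
  by rewrite mulr_gt0 // ltr_pwDl // sqr_ge0.
near=> h.
have h1 : `|h| <= 1 by near: h; apply/(@nbhs_norm0P R (triple R n)); exists 1 => //= y /ltW.
have hsmall : `|h| <= e%:num / (K * (1 + C ^+ 2)).
  near: h; apply/(@nbhs_norm0P R (triple R n)); exists (e%:num / (K * (1 + C ^+ 2))) => [|y /ltW //].
  by rewrite /= divr_gt0.
have -> : (G Lam \o shift X - (cst (G Lam X) + dG X)) h = G_remainder X h.
  rewrite !fctE /= [h + X]addrC G_expansion.
  by rewrite addrAC subrr add0r.
apply: le_trans (mx_norm_le_frob _) _.
have hC := triple_norm_le_norm h.
have hC1 : triple_norm h <= C by apply: le_trans hC _; rewrite ler_piMr.
apply: le_trans (G_remainder_bound (_ : _ <= K)) _; first by rewrite /K lerD2l.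
rewrite ler_pdivlMr // in hsmall.
apply: (@le_trans _ _ (K * (C * `|h|) ^+ 2)).
  by rewrite ler_pM2l // ler_sqr ?nnegrE ?triple_norm_ge0 ?mulr_ge0.
apply: (@le_trans _ _ (`|h| * (K * (1 + C ^+ 2)) * `|h|)); last by rewrite ler_wpM2r.
have : 0 <= K * `|h| ^+ 2 by rewrite mulr_ge0 ?sqr_ge0 // ltW.
by rewrite expr2 /=; lra.
Unshelve. all: by end_near. Qed.

End Differential.

(** * Adjoint and retraction *)

Section Manifold.
Variables (R : realType) (n : nat) (Lam : 'M[R]_n).
Implicit Types (X xi zeta : triple R n) (Q Z Om : 'M[R]_n).

Lemma tangent0 X : tangent Lam X 0.
Proof.
split; last by move=> i j _; rewrite mxE.
by exists 0; split; rewrite ?trmx0 ?oppr0 ?mulmx0.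
Qed.

Lemma tangentD X xi zeta :
  tangent Lam X xi -> tangent Lam X zeta -> tangent Lam X (xi + zeta).
Proof.
move=> [[Om1 [skew1 xi2]] Vxi] [[Om2 [skew2 zeta2]] Vzeta]; split.
  exists (Om1 + Om2); split; first by rewrite linearD /= skew1 skew2 opprD.
  by rewrite /= xi2 zeta2 mulmxDr.
by move=> i j ij; rewrite mxE Vxi // Vzeta // addr0.
Qed.

Lemma tangentZ X a xi : tangent Lam X xi -> tangent Lam X (a *: xi).
Proof.
move=> [[Om [skew xi2]] Vxi]; split.
  exists (a *: Om); split; first by rewrite linearZ /= skew scalerN.
  by rewrite /= xi2 scalemxAr.
by move=> i j ij; rewrite mxE Vxi // mulr0.
Qed.

Lemma tangent_sum X (I : finType) (F : I -> triple R n) :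
  (forall i, tangent Lam X (F i)) -> tangent Lam X (\sum_i F i).
Proof.
by move=> tF; elim/big_rec: _ => [|i x _ tx]; [exact: tangent0 | exact: tangentD].
Qed.

Lemma frob_dot_conj Q (Y Z : 'M[R]_n) :
  frob_dot (Q *m Y *m Q^T) Z = frob_dot Y (Q^T *m Z *m Q).
Proof.
by rewrite /frob_dot !trmx_mul trmxK -!mulmxA mxtrace_mulC !mulmxA.
Qed.

Lemma frob_dot_mulr (A B C : 'M[R]_n) : frob_dot (A *m B) C = frob_dot A (C *m B^T).
Proof. by rewrite /frob_dot trmx_mul -mulmxA mxtrace_mulC -mulmxA. Qed.

Lemma frob_dot_trmx (A B : 'M[R]_n) : frob_dot A^T B = frob_dot A B^T.
Proof. by rewrite /frob_dot trmxK -[LHS]mxtrace_tr trmx_mul mxtrace_mulC. Qed.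

(** The adjoint is explicit. With [W] the conjugate of [Z] by [Q], its parts are [2 *: (S o Z)]
    (Hadamard product), [Q] times minus the skew part of [Y], and minus the projection [PW] of [W]
    onto [Vspace Lam]. *)
Lemma DG_adj_exists X Z : orthogonal_group X.1.2 ->
  exists xi, tangent Lam X xi /\
    forall zeta, tangent Lam X zeta -> frob_dot (DG Lam X zeta) Z = metric zeta xi.
Proof.
case: X => [[S Q] V] /= QQ; pose M := Lam + V; pose W := Q^T *m Z *m Q.
pose Y := W *m M^T + W^T *m M; pose Om := - (2^-1 *: (Y - Y^T)).
pose PW : 'M[R]_n := \matrix_(i, j) if fixed_index Lam i j then 0 else W i j.
exists (2 *: map2_mx *%R S Z, Q *m Om, - PW); split.
  split=> [|i j ij] /=; last by rewrite !mxE ij oppr0.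
  exists Om; split=> //; rewrite /Om linearN linearZ linearB /= trmxK.
  by rewrite -scalerN opprB opprK.
move=> [[A B] E] [[Om' [/= skew ->]] VE]; rewrite DG_E /dG /metric /=.
have dS : frob_dot (2 *: map2_mx *%R S A) Z = frob_dot A (2 *: map2_mx *%R S Z).
  by rewrite !frob_dotE; apply: eq_bigr => p _; rewrite !mxE; ring.
have dE : frob_dot E W = frob_dot E PW.
  rewrite !frob_dotE; apply: eq_bigr => p _; rewrite [PW _ _]mxE.
  by case: ifP => // fp; rewrite VE // !mul0r.
have dOm : frob_dot (Q *m Om') (Q *m Om) = frob_dot Om' Om.
  by rewrite /frob_dot trmx_mul mulmxA -(mulmxA _ Q^T) QQ mulmx1.
have dY : frob_dot Om' Om = - frob_dot Om' Y.
  have skewY : frob_dot Om' Y^T = - frob_dot Om' Y by rewrite -frob_dot_trmx skew frob_dotNl.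
  by rewrite /Om frob_dotNr frob_dotZr frob_dotDr frob_dotNr skewY; field.
rewrite frob_dotBl dS dOm dY frob_dotNr -dE -[RHS]addrA; congr (_ + _).
rewrite trmx_mul -/M.
have factorQ (N : 'M[R]_n) :
    Q *m Om' *m N *m Q^T + Q *m E *m Q^T + Q *m N *m (Om'^T *m Q^T)
    = Q *m (Om' *m N + E + N *m Om'^T) *m Q^T by rewrite !mulmxDr !mulmxDl !mulmxA.
rewrite factorQ.
rewrite frob_dot_conj -/W !frob_dotDl frob_dot_mulr.
have -> : frob_dot (M *m Om'^T) W = frob_dot Om' (W^T *m M).
  by rewrite -[M in LHS]trmxK -trmx_mul frob_dot_trmx frob_dot_mulr trmxK.
by rewrite /Y frob_dotDr; ring.
Qed.

Lemma DG_adjP X Z : orthogonal_group X.1.2 ->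
  tangent Lam X (DG_adj Lam X Z) /\ forall zeta, tangent Lam X zeta ->
    frob_dot (DG Lam X zeta) Z = metric zeta (DG_adj Lam X Z).
Proof.
move=> QX; have [xi xiP] := DG_adj_exists Z QX.
by rewrite /DG_adj; case: xgetP => [_ _ //|/(_ xi) /(_ xiP)].
Qed.

Lemma orthogonal_qf (A : 'M[R]_n) : orthogonal_group (qf A).
Proof.
rewrite /qf; case: xgetP => [Q _ []//|_].
by rewrite /orthogonal_group /= trmx1 mulmx1.
Qed.

Lemma retraction_domain X xi :
  domain Lam X -> tangent Lam X xi -> domain Lam (retraction X xi).
Proof.
move=> [_ VX] [_ Vxi]; split; first exact: orthogonal_qf.
by move=> i j ij; rewrite mxE VX // Vxi // addr0.
Qed.

(** [E] is the error of the QR factor against [Q + zeta]. The linear bound holds for steps of any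
    size and controls the displacement; the quadratic one makes the retraction first order. *)
Lemma retraction_expansion X xi :
  orthogonal_group X.1.2 -> tangent Lam X xi ->
  exists E : 'M[R]_n, [/\ retraction X xi = X + (xi + (0, E, 0)),
    frob_norm E <= triple_norm xi & frob_norm E <= 2 * triple_norm xi ^+ 2].
Proof.
case: X => [[S Q] V]; case: xi => [[A B] C] /= QQ [[Om [/= skew ->]] _].
pose P := qf (Q + Q *m Om).
have qfP : is_qf (Q + Q *m Om) P.
  have [P' P'P] := is_qf_exists (unitmx_add_skew QQ skew).
  by rewrite /P /qf; case: xgetP => [_ _ //|/(_ P') /(_ P'P)].
have [E1 E2] := is_qf_tangent QQ skew qfP.
have leOm : frob_norm Om <= triple_norm (A, Q *m Om, C).
  rewrite /triple_norm /= frob_norm_orthl //.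
  by have := frob_norm_ge0 A; have := frob_norm_ge0 C; lra.
exists (P - (Q + Q *m Om)); split.
- by rewrite /retraction /= -/P; congr (_, _, _); rewrite /= ?addr0 // addrA addrC subrK.
- exact: le_trans leOm.
- apply: le_trans E2 _; rewrite ler_pM2l // ler_sqr ?nnegrE ?frob_norm_ge0 //.
  exact: triple_norm_ge0.
Qed.

Lemma triple_norm_mid (E : 'M[R]_n) : triple_norm (0, E, 0) = frob_norm E.
Proof. by rewrite /triple_norm /= frob_norm0 add0r addr0. Qed.

Lemma retraction_dist X xi : orthogonal_group X.1.2 -> tangent Lam X xi ->
  triple_norm (retraction X xi - X) <= 2 * triple_norm xi.
Proof.
move=> QX txi; have [E [-> leE _]] := retraction_expansion QX txi.
rewrite addrAC subrr add0r; apply: le_trans (triple_normD _ _) _.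
by rewrite triple_norm_mid; lra.
Qed.

(** The true displacement [h] has norm at most twice that of [xi], hence at most 2, which explains
    the 3 in the bound on [K]. The constant is [2 * (2 * K + 3 * K ^+ 2)] from the derivative at the
    error [E], plus [4 * K] from the remainder at [h]. *)
Lemma G_retraction X xi K : orthogonal_group X.1.2 -> tangent Lam X xi ->
  3 + frob_norm Lam + triple_norm X <= K -> triple_norm xi <= 1 ->
  frob_norm (G Lam (retraction X xi) - G Lam X - DG Lam X xi)
    <= (8 * K + 6 * K ^+ 2) * triple_norm xi ^+ 2.
Proof.
move=> QX txi leK le1; have [E [-> E1 E2]] := retraction_expansion QX txi.
set h := xi + _; have hN : triple_norm h <= 2 * triple_norm xi.
  by apply: le_trans (triple_normD _ _) _; rewrite triple_norm_mid; lra.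
have -> : G Lam (X + h) - G Lam X - DG Lam X xi = dG Lam X (0, E, 0) + G_remainder Lam X h.
  rewrite G_expansion DG_E /h linearD /=.
  move: (G_remainder _ _ _) (dG _ _ _) (dG _ _ _) (G _ _) => a b c d.
  by apply/matrixP => i j; rewrite !mxE; ring.
apply: le_trans (frob_normD _ _) _.
have K0 : 0 <= K by have := frob_norm_ge0 Lam; have := triple_norm_ge0 X; lra.
have : frob_norm (dG Lam X (0, E, 0)) <= (2 * K + 3 * K ^+ 2) * (2 * triple_norm xi ^+ 2).
  apply: le_trans (dG_bound _ (_ : _ <= K)) _; first by lra.
  by rewrite triple_norm_mid ler_wpM2l // addr_ge0 ?mulr_ge0 ?sqr_ge0.
have : frob_norm (G_remainder Lam X h) <= K * (2 * triple_norm xi) ^+ 2.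
  apply: le_trans (G_remainder_bound (_ : _ <= K)) _; first by lra.
  by rewrite ler_wpM2l // ler_sqr ?nnegrE ?mulr_ge0 ?triple_norm_ge0.
by lra.
Qed.

End Manifold.

(** * Lipschitz comparison with a fixed centre *)

Section LocallyLipschitz.
Variables (R : realType) (n : nat) (Y : triple R n).
Implicit Types (f g : triple R n -> 'M[R]_n).

(** Points of the unit ball are compared with the centre [Y] only, not with each other; this is
    stable under sums and products. *)
Definition lipschitz_near f : Prop := exists2 C, 0 <= C &
  forall X, triple_norm (X - Y) <= 1 -> frob_norm (f X - f Y) <= C * triple_norm (X - Y).

Lemma lipschitz_near_cst (A : 'M[R]_n) : lipschitz_near (fun=> A).
Proof. by exists 0 => // X _; rewrite subrr frob_norm0 mul0r. Qed.

Lemma lipschitz_near_proj :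
  [/\ lipschitz_near (fun X => X.1.1), lipschitz_near (fun X => X.1.2)
    & lipschitz_near (fun X => X.2)].
Proof.
split; exists 1 => // X _; rewrite mul1r /triple_norm /=.
- by rewrite -addrA lerDl addr_ge0 ?frob_norm_ge0.
- by rewrite addrAC lerDr addr_ge0 ?frob_norm_ge0.
- by rewrite lerDr addr_ge0 ?frob_norm_ge0.
Qed.

Lemma lipschitz_nearD f g :
  lipschitz_near f -> lipschitz_near g -> lipschitz_near (fun X => f X + g X).
Proof.
move=> [C C0 fC] [D D0 gD]; exists (C + D) => [|X X1]; first exact: addr_ge0.
rewrite opprD addrACA; apply: le_trans (frob_normD _ _) _.
by rewrite mulrDl lerD ?fC ?gD.
Qed.

Lemma lipschitz_nearN f : lipschitz_near f -> lipschitz_near (fun X => - f X).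
Proof.
by move=> [C C0 fC]; exists C => // X X1; rewrite -opprD frob_normN fC.
Qed.

Lemma lipschitz_near_tr f : lipschitz_near f -> lipschitz_near (fun X => (f X)^T).
Proof.
by move=> [C C0 fC]; exists C => // X X1; rewrite -linearB /= frob_norm_tr fC.
Qed.

(** The product rule, shared by the matrix and Hadamard products. The factor [frob_norm (g Y) + D]
    bounds [g] on the unit ball. *)
Lemma lipschitz_near_bilinear (op : 'M[R]_n -> 'M[R]_n -> 'M[R]_n) f g :
  (forall A B C D, op A B - op C D = op (A - C) B + op C (B - D)) ->
  (forall A B, frob_norm (op A B) <= frob_norm A * frob_norm B) ->
  lipschitz_near f -> lipschitz_near g -> lipschitz_near (fun X => op (f X) (g X)).
Proof.
move=> opB opN [C C0 fC] [D D0 gD].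
exists (C * (frob_norm (g Y) + D) + frob_norm (f Y) * D) => [|X X1].
  by rewrite addr_ge0 ?mulr_ge0 ?addr_ge0 ?frob_norm_ge0.
rewrite opB; apply: le_trans (frob_normD _ _) _; rewrite mulrDl lerD //.
  apply: le_trans (opN _ _) _; rewrite mulrAC ler_pM ?frob_norm_ge0 ?fC //.
  rewrite -[g X](subrK (g Y)); apply: le_trans (frob_normD _ _) _.
  by rewrite addrC lerD2l; apply: le_trans (gD X X1) _; rewrite ler_piMr.
by apply: le_trans (opN _ _) _; rewrite -mulrA ler_wpM2l ?frob_norm_ge0 ?gD.
Qed.

Lemma lipschitz_near_mulmx f g :
  lipschitz_near f -> lipschitz_near g -> lipschitz_near (fun X => f X *m g X).
Proof.
apply: lipschitz_near_bilinear => [A B C D|A B]; last exact: frob_normM.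
by rewrite mulmxBl mulmxBr addrA subrK.
Qed.

Lemma lipschitz_near_hadamard f g :
  lipschitz_near f -> lipschitz_near g -> lipschitz_near (fun X => map2_mx *%R (f X) (g X)).
Proof.
apply: lipschitz_near_bilinear => [A B C D|A B]; last exact: frob_norm_hadamard.
by apply/matrixP => i j; rewrite !mxE; ring.
Qed.

Lemma lipschitz_near_G (Lam : 'M[R]_n) : lipschitz_near (G Lam).
Proof.
have [l1 l2 l3] := lipschitz_near_proj.
apply: lipschitz_nearD; first exact: lipschitz_near_hadamard.
apply/lipschitz_nearN/lipschitz_near_mulmx; last exact: lipschitz_near_tr.
apply: lipschitz_near_mulmx => //; apply: lipschitz_nearD => //.
exact: lipschitz_near_cst.
Qed.

(** The skew matrix [Om] is fixed while [Q] moves with [X]: this carries a tangent vector from one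
    base point to another. *)
Lemma lipschitz_near_dG (Lam A Om E : 'M[R]_n) :
  lipschitz_near (fun X => dG Lam X (A, X.1.2 *m Om, E)).
Proof.
have [l1 l2 l3] := lipschitz_near_proj; have c B := lipschitz_near_cst B.
have lM : lipschitz_near (fun X => Lam + X.2) by exact: lipschitz_nearD.
have lOm : lipschitz_near (fun X => X.1.2 *m Om) by exact: lipschitz_near_mulmx.
have lT := lipschitz_near_tr l2.
apply: lipschitz_nearD => /=.
  have -> : (fun X : triple R n => 2 *: map2_mx *%R X.1.1 A) =
      (fun X => map2_mx *%R X.1.1 A + map2_mx *%R X.1.1 A).
    by apply/funext => X; rewrite scaler_nat mulr2n.
  by apply: lipschitz_nearD; exact: lipschitz_near_hadamard.
apply/lipschitz_nearN/lipschitz_nearD; first apply: lipschitz_nearD.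
- by apply: lipschitz_near_mulmx => //; exact: lipschitz_near_mulmx.
- by apply: lipschitz_near_mulmx => //; exact: lipschitz_near_mulmx.
- apply: lipschitz_near_mulmx; first exact: lipschitz_near_mulmx.
  exact: lipschitz_near_tr.
Qed.

End LocallyLipschitz.

(** * Uniform coercivity near Xbar *)

Section Coercivity.
Variables (R : realType) (n : nat) (Lam : 'M[R]_n) (Xbar : triple R n).
Hypothesis surjective_DG :
  forall W : 'M[R]_n, exists2 xi, tangent Lam Xbar xi & DG Lam Xbar xi = W.

(* A right inverse of DG at Xbar, with tangent vectors Q Om moved to the
   tangent space at X, is still a right inverse of DG X up to an error 1/2. *)
Lemma tangent_right_inverse : exists delta K : R, [/\ 0 < delta, 0 < K &
  forall (X : triple R n) Z, triple_norm (X - Xbar) <= delta -> exists zeta,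
    [/\ tangent Lam X zeta, triple_norm zeta <= K * frob_norm Z
      & frob_norm (DG Lam X zeta - Z) <= 2^-1 * frob_norm Z]].
Proof.
(* Preimages of the matrix units under the derivative at [Xbar]; the middle component stores the
   skew matrix [Om] in place of [Q *m Om]. *)
have /choice [D DP] : forall p : 'I_n * 'I_n, exists D : triple R n,
    [/\ D.1.2^T = - D.1.2, Vspace Lam D.2
      & dG Lam Xbar (D.1.1, Xbar.1.2 *m D.1.2, D.2) = delta_mx p.1 p.2].
  move=> p; have [xi [[Om [skew xi2]] Vxi] <-] := surjective_DG (delta_mx p.1 p.2).
  exists (xi.1.1, Om, xi.2); split => //=.
  by rewrite DG_E -xi2; case: xi {xi2 Vxi} => -[].
pose T p (X : triple R n) : triple R n := ((D p).1.1, X.1.2 *m (D p).1.2, (D p).2).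
have /choice [C CP] : forall p, exists C : R, 0 <= C /\ forall X : triple R n, triple_norm (X - Xbar) <= 1 ->
    frob_norm (dG Lam X (T p X) - delta_mx p.1 p.2) <= C * triple_norm (X - Xbar).
  move=> p; have [_ _ <-] := DP p.
  by have [C C0 CP] := lipschitz_near_dG Xbar Lam (D p).1.1 (D p).1.2 (D p).2; exists C.
pose S := \sum_p C p; have S_ge0 : 0 <= S by apply: sumr_ge0 => p _; case: (CP p).
pose B p := frob_norm (D p).1.1 + (triple_norm Xbar + 1) * frob_norm (D p).1.2
  + frob_norm (D p).2.
pose K := 1 + \sum_p B p.
have B_ge0 p : 0 <= B p by rewrite !addr_ge0 ?mulr_ge0 ?addr_ge0 ?triple_norm_ge0 ?frob_norm_ge0.
have S1_gt0 : 0 < 2 * (S + 1) by rewrite mulr_gt0 // ltr_wpDl.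
(* With this radius the errors [C p] add up to at most [S / (2 * (S + 1))], which is below one
   half. *)
exists (Num.min 1 (2 * (S + 1))^-1), K; split.
- by rewrite lt_min ltr01 invr_gt0.
- by rewrite ltr_pwDl // sumr_ge0.
move=> X Z; rewrite le_min => /andP[X1 XS].
exists (\sum_p Z p.1 p.2 *: T p X); split.
- apply: tangent_sum => p; apply: tangentZ; have [skew VD _] := DP p.
  by split=> //; exists (D p).1.2.
- apply: le_trans (triple_norm_sum _) _; rewrite mulrDl mul1r mulr_suml.
  apply: ler_wpDl; first exact: frob_norm_ge0.
  apply: ler_sum => p _; rewrite triple_normZ mulrC ler_pM ?triple_norm_ge0 //; last exact: frob_norm_entry.
  rewrite /triple_norm /B /= lerD2r lerD2l; apply: le_trans (frob_normM _ _) _.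
  rewrite ler_wpM2r ?frob_norm_ge0 //.
  apply: (@le_trans _ _ (triple_norm X)).
    by rewrite /triple_norm addrAC lerDr addr_ge0 ?frob_norm_ge0.
  rewrite -[X](subrK Xbar); apply: le_trans (triple_normD _ _) _.
  by rewrite addrC lerD2l.
- rewrite DG_E linear_sum /= [X in _ - X]matrix_sum_delta.
  rewrite (pair_bigA _ (fun i j => Z i j *: delta_mx i j)) /= -sumrB.
  apply: le_trans (frob_norm_sum _) _.
  apply: (@le_trans _ _ (\sum_p frob_norm Z * (C p * (2 * (S + 1))^-1))).
    apply: ler_sum => p _; rewrite linearZ /= -scalerBr frob_normZ.
    rewrite ler_pM ?frob_norm_ge0 ?frob_norm_entry //.
    have [C0 Cp] := CP p; apply: le_trans (Cp _ X1) _.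
    by rewrite ler_wpM2l.
  rewrite -mulr_sumr -mulr_suml -/S mulrC ler_wpM2r ?frob_norm_ge0 //.
  by rewrite ler_pdivrMr //; lra.
Qed.

(** Write [xi] for the adjoint at [Z] and take [zeta] from the approximate right inverse. Then half
    of |Z|^2 is at most the product of [DG zeta] with [Z], that is of [zeta] with [xi], so |Z| <=
    2K|xi|. Moreover |xi|^2 <= 3 |DG xi| |Z|, and dividing by |xi| gives the factor 6K. *)
Lemma DG_adj_bound : exists delta K : R, [/\ 0 < delta, 0 < K &
  forall (X : triple R n) Z, orthogonal_group X.1.2 -> triple_norm (X - Xbar) <= delta ->
    triple_norm (DG_adj Lam X Z) <= K * frob_norm (DG Lam X (DG_adj Lam X Z))].
Proof.
have [delta [K [delta_gt0 K_gt0 rinv]]] := tangent_right_inverse.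
exists delta, (6 * K); split=> // [|X Z QX Xnear]; first by rewrite mulr_gt0.
have [zeta [tzeta zetaK zetaZ]] := rinv X Z Xnear.
have [tadj adjP] := DG_adjP Lam Z QX; set xi := DG_adj Lam X Z in tadj adjP *.
have Z_le : frob_norm Z <= 2 * K * triple_norm xi.
  have [->|Z_neq0] := eqVneq (frob_norm Z) 0.
    by rewrite !mulr_ge0 ?triple_norm_ge0 // ltW.
  have Z_gt0 : 0 < frob_norm Z by rewrite lt0r Z_neq0 frob_norm_ge0.
  have lower : 2^-1 * frob_norm Z ^+ 2 <= frob_dot (DG Lam X zeta) Z.
    rewrite -[DG Lam X zeta](subrK Z) frob_dotDl -frob_norm_sqr.
    have := frob_cauchy_schwarz (- (DG Lam X zeta - Z)) Z.
    rewrite frob_dotNl frob_normN => cs.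
    have : frob_norm (DG Lam X zeta - Z) * frob_norm Z <= 2^-1 * frob_norm Z * frob_norm Z.
      by rewrite ler_pM2r.
    rewrite expr2; lra.
  have upper : frob_dot (DG Lam X zeta) Z <= K * frob_norm Z * triple_norm xi.
    rewrite adjP //; apply: le_trans (metric_le _ _) _.
    by rewrite ler_wpM2r ?triple_norm_ge0.
  by rewrite -(ler_pM2r Z_gt0); rewrite expr2 in lower; lra.
have xi2 : triple_norm xi ^+ 2 <= 3 * (frob_norm (DG Lam X xi) * frob_norm Z).
  apply: le_trans (triple_norm_sqr_le _) _; rewrite ler_pM2l // -adjP //.
  exact: frob_cauchy_schwarz.
have [->|xi_neq0] := eqVneq (triple_norm xi) 0.
  by rewrite !mulr_ge0 ?frob_norm_ge0 // ltW.
have xi_gt0 : 0 < triple_norm xi by rewrite lt0r xi_neq0 triple_norm_ge0.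
rewrite -(ler_pM2r xi_gt0) -expr2; apply: le_trans xi2 _.
have := ler_wpM2l (frob_norm_ge0 (DG Lam X xi)) Z_le; lra.
Qed.

End Coercivity.

(** * One step of the method *)

Section Step.
Variables (R : realType) (n : nat) (Lam : 'M[R]_n).
Variables (sigma_max eta_max etahat_max t theta_min theta_max : R).
Hypotheses (etahat_lt1 : etahat_max < 1)
  (t_gt0 : 0 < t) (t_lt1 : t < 1).
Hypotheses (theta_min_gt0 : 0 < theta_min) (theta_max_lt1 : theta_max < 1).
Implicit Types (X dX : triple R n) (eta : R).

Local Notation gap X := (frob_norm (G Lam X)).
Local Notation step := (newton_cg_step Lam sigma_max eta_max etahat_max t theta_min theta_max).

Lemma gap_gt0 X : G Lam X != 0 -> 0 < gap X.
Proof.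
by move=> G0; rewrite lt0r frob_norm_ge0 andbT; apply: contra_neq G0; exact: frob_norm_eq0.
Qed.

(** Shrinking by [theta >= 0] preserves [eta <= 1], so the factor in the acceptance test is at most
    1. This applies at every iterate, near [Xbar] or far from it. *)
Lemma backtrack_descent X dX eta dX' :
  backtrack Lam t theta_min theta_max X dX eta dX' ->
  tangent Lam X dX -> eta <= 1 ->
  tangent Lam X dX' /\ gap (retraction X dX') <= gap X.
Proof.
elim=> {dX eta dX'} [dX eta sd|dX eta theta dX' _ /andP[th _] _ IH] tdX eta1.
  split=> //; apply: le_trans sd _; rewrite ler_piMl ?frob_norm_ge0 //.
  by have := mulr_ge0 (ltW t_gt0) (_ : 0 <= 1 - eta); rewrite subr_ge0; lra.
apply: IH; first exact: tangentZ.
have theta_ge0 : 0 <= theta by apply: le_trans th; exact: ltW.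
by have : 0 <= theta * (1 - eta); [rewrite mulr_ge0 // subr_ge0 | lra].
Qed.

Lemma eta_hat_le X dZ : G Lam X != 0 ->
  inexact_solution Lam sigma_max eta_max etahat_max X dZ ->
  eta_hat Lam X (DG_adj Lam X dZ) <= etahat_max.
Proof.
by move=> /gap_gt0 g0 [_ _ solb]; rewrite /eta_hat ler_pdivrMr.
Qed.

Lemma step_descent X X' : domain Lam X -> G Lam X != 0 -> step X X' ->
  domain Lam X' /\ gap X' <= gap X.
Proof.
move=> dX G0 [dZ [sol [xi [bt ->]]]]; have [tadj _] := DG_adjP Lam dZ dX.1.
have [||txi gle] := backtrack_descent bt => //.
  by apply: le_trans (eta_hat_le G0 sol) _; exact: ltW.
by split=> //; exact: retraction_domain.
Qed.

(** The loop preserves the length bound, the residual bound and [c <= 1 - eta]. The hypothesis on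
    [sufficient_decrease] says that steps no longer than [delta] are accepted, so a shrinking only
    happens to a longer step. *)
Lemma backtrack_step_bound X dX eta dX' Gamma delta c :
  0 < gap X -> 0 < Gamma -> 0 < delta ->
  (forall xi e, tangent Lam X xi -> triple_norm xi <= Gamma * (1 - e) * gap X ->
    frob_norm (DG Lam X xi + G Lam X) <= e * gap X -> triple_norm xi <= delta ->
    sufficient_decrease Lam t X xi e) ->
  0 < c -> c * (Gamma * gap X) <= theta_min * delta ->
  backtrack Lam t theta_min theta_max X dX eta dX' ->
  tangent Lam X dX -> triple_norm dX <= Gamma * (1 - eta) * gap X ->
  frob_norm (DG Lam X dX + G Lam X) <= eta * gap X -> c <= 1 - eta ->
  exists e, [/\ tangent Lam X dX', sufficient_decrease Lam t X dX' e,
    triple_norm dX' <= Gamma * (1 - e) * gap X & c <= 1 - e].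
Proof.
move=> g0 Gamma0 delta0 SD c0 c_small.
elim=> {dX eta dX'} [dX eta sd|dX eta theta dX' nsd /andP[th1 th2] _ IH] tdX dXle res ceta.
  by exists eta.
have theta_gt0 : 0 < theta by exact: lt_le_trans th1.
have theta_lt1 : theta < 1 by exact: le_lt_trans th2 _.
apply: IH; first exact: tangentZ.
- rewrite triple_normZ gtr0_norm // subKr.
  by have := ler_wpM2l (ltW theta_gt0) dXle; lra.
(* A convex combination of the old residual and of [G Lam X], whence the new value
   [1 - theta * (1 - eta)]. *)
- have -> : DG Lam X (theta *: dX) + G Lam X =
      theta *: (DG Lam X dX + G Lam X) + (1 - theta) *: G Lam X.
    by rewrite /DG linearZ /= scalerDr scalerBl scale1r -addrA [theta *: G _ _ + _]addrC subrK.
  apply: le_trans (frob_normD _ _) _; rewrite !frob_normZ gtr0_norm // ger0_norm; last by rewrite subr_ge0 ltW.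
  by have := ler_wpM2l (ltW theta_gt0) res; lra.
- rewrite subKr.
  (* A rejected step is long, so the length bound forces [Gamma * (1 - eta) * gap X] above [delta];
     the factor [theta >= theta_min] then keeps the new [1 - eta] above [c]. *)
  have big : delta < triple_norm dX.
    by rewrite ltNge; apply/negP => small; apply: nsd; exact: SD.
  have Gg0 : 0 < Gamma * gap X by rewrite mulr_gt0.
  rewrite -(ler_pM2r Gg0); apply: le_trans c_small _.
  apply: (@le_trans _ _ (theta * delta)); first by rewrite ler_wpM2r // ltW.
  rewrite -mulrA ler_pM2l //; apply: le_trans (ltW big) _; apply: le_trans dXle _.
  by rewrite mulrAC mulrC.
Qed.

Lemma step_near Xbar g0 : 0 < g0 ->
  (forall W : 'M[R]_n, exists2 xi, tangent Lam Xbar xi & DG Lam Xbar xi = W) ->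
  exists delta K c : R, [/\ 0 < delta, 0 < K, 0 < c & forall X X',
    domain Lam X -> G Lam X != 0 -> gap X <= g0 ->
    triple_norm (X - Xbar) <= delta -> step X X' ->
    triple_norm (X' - X) <= K * (gap X - gap X') /\ gap X' <= (1 - c) * gap X].
Proof.
move=> g0_gt0 surj; have [delta [K [delta_gt0 K_gt0 adjK]]] := DG_adj_bound surj.
have eh_gt0 : 0 < 1 - etahat_max by rewrite subr_gt0.
(* The initial step [xi] has |DG xi| <= 2|G| because its residual is at most |G|; coercivity gives
   |xi| <= 2K|G|, and [1 - etahat_max] is at most [1 - e0]. *)
pose Gamma := 2 * K / (1 - etahat_max).
have Gamma_gt0 : 0 < Gamma by rewrite !(divr_gt0, mulr_gt0).
(* The 3 required by [G_retraction], plus 1 for the distance from [X] to [Xbar]. *)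
pose L := 4 + frob_norm Lam + triple_norm Xbar.
have L_gt0 : 0 < L by have := frob_norm_ge0 Lam; have := triple_norm_ge0 Xbar; rewrite /L; lra.
pose C := 8 * L + 6 * L ^+ 2.
have C_gt0 : 0 < C by rewrite addr_gt0 ?mulr_gt0 ?exprn_gt0.
(* Below this length the quadratic error is at most [(1 - t) * (1 - e) * gap X], exactly the slack
   left by the acceptance test. *)
pose d := Num.min 1 ((1 - t) / (C * Gamma)).
have d_gt0 : 0 < d.
  by rewrite lt_min ltr01 divr_gt0 //= ?subr_gt0 //; exact: mulr_gt0.
(* The first term serves the initial value of [1 - eta], the second the values after a shrinking;
   [g0] makes the latter uniform in [X]. *)
pose c := Num.min (1 - etahat_max) (theta_min * d / (Gamma * g0)).
have c_gt0 : 0 < c by rewrite lt_min eh_gt0 divr_gt0 //=; exact: mulr_gt0.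
exists (Num.min 1 delta), (2 * Gamma / t), (t * c); split.
- by rewrite lt_min ltr01 delta_gt0.
- by rewrite divr_gt0 // mulr_gt0.
- by rewrite mulr_gt0.
move=> X X' domX GX_neq0 gX; rewrite le_min => /andP[near1 near_d].
move=> [dZ [sol [dX [bt ->]]]].
have gX0 := gap_gt0 GX_neq0; have QX := domX.1.
have eh := eta_hat_le GX_neq0 sol.
have [tadj _] := DG_adjP Lam dZ QX.
set xi := DG_adj Lam X dZ in bt eh tadj; set e0 := eta_hat Lam X xi in bt eh.
have SD xi' e : tangent Lam X xi' -> triple_norm xi' <= Gamma * (1 - e) * gap X ->
    frob_norm (DG Lam X xi' + G Lam X) <= e * gap X -> triple_norm xi' <= d ->
    sufficient_decrease Lam t X xi' e.
  move=> txi' xi'le res; rewrite le_min => /andP[xi'1 xi'C].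
  have leL : 3 + frob_norm Lam + triple_norm X <= L.
    have : triple_norm X <= triple_norm (X - Xbar) + triple_norm Xbar.
      by rewrite -{1}[X](subrK Xbar) triple_normD.
    by rewrite /L; lra.
  have := G_retraction QX txi' leL xi'1; rewrite -/C => lin.
  rewrite /sufficient_decrease.
  have -> : G Lam (retraction X xi') =
      G Lam (retraction X xi') - G Lam X - DG Lam X xi' + (DG Lam X xi' + G Lam X).
    by rewrite addrA !subrK.
  apply: le_trans (frob_normD _ _) _.
  have : C * triple_norm xi' ^+ 2 <= (1 - t) * (1 - e) * gap X.
    apply: (@le_trans _ _ (C * triple_norm xi' * (Gamma * (1 - e) * gap X))).
      by rewrite expr2 mulrA ler_wpM2l // mulr_ge0 ?triple_norm_ge0 ?ltW.
    have e1 : 0 <= (1 - e) * gap X.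
      by rewrite -(pmulr_rge0 _ Gamma_gt0) mulrA; apply: le_trans xi'le; exact: triple_norm_ge0.
    have : triple_norm xi' * (C * Gamma) <= 1 - t by rewrite -ler_pdivlMr //; exact: mulr_gt0.
    by move/(ler_wpM2r e1); lra.
  by move: lin; lra.
have [||||e [tdX sd dXle ce]] := backtrack_step_bound gX0 Gamma_gt0 d_gt0 SD c_gt0 _ bt tadj.
- apply: (@le_trans _ _ (c * (Gamma * g0))).
    by rewrite ler_pM2l // ler_pM2l.
  rewrite -ler_pdivlMr; last exact: mulr_gt0.
  by rewrite /c ge_min lexx orbT.
- apply: le_trans (adjK X dZ QX near_d) _; rewrite -/xi.
  have DGle : frob_norm (DG Lam X xi) <= 2 * gap X.
    rewrite -[DG Lam X xi](addrK (G Lam X)); apply: le_trans (frob_normB _ _) _.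
    case: sol => _ _; rewrite /normal_op -/xi => solb.
    have : etahat_max * gap X <= gap X by rewrite ler_piMl ?ltW.
    by lra.
  have : 2 * K <= Gamma * (1 - e0).
    by rewrite -[2 * K](divfK (lt0r_neq0 eh_gt0)) ler_pM2l // lerB.
  move=> /(ler_wpM2r (ltW gX0)); have := ler_wpM2l (ltW K_gt0) DGle; lra.
- by rewrite /e0 /eta_hat divfK ?lt0r_neq0.
- by apply: le_trans (_ : _ <= 1 - etahat_max) _; [rewrite /c ge_min lexx | rewrite lerB].
(* The decrease of |G| dominates [t * (1 - e) * gap X], while the displacement is at most twice
   [Gamma * (1 - e) * gap X]: hence the ratio [2 * Gamma / t]. *)
have sd' : t * ((1 - e) * gap X) <= gap X - gap (retraction X dX).
  by move: sd; rewrite /sufficient_decrease; lra.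
split.
  apply: le_trans (retraction_dist QX tdX) _.
  rewrite -[2 * Gamma / t * _]mulrA -[2 * Gamma * _]mulrA ler_pM2l //.
  apply: le_trans dXle _.
  by rewrite -mulrA ler_pM2l // ler_pdivlMl.
apply: le_trans sd _; by rewrite ler_pM2r // lerB // ler_pM2l.
Qed.

End Step.

(** * Convergence *)

Lemma triple_norm_nbhs (R : realType) n (Y : triple R n) (e : R) :
  0 < e -> nbhs Y [set X : triple R n | triple_norm (X - Y) <= e].
Proof.
move=> e_gt0; have C_gt0 : 0 < 3 * n%:R + 1 :> R by rewrite ltr_wpDl ?mulr_ge0 ?ler0n.
apply/(@nbhs_normP R (triple R n)); exists (e / (3 * n%:R + 1)); first exact: divr_gt0.
move=> X /=; rewrite distrC ltr_pdivlMr // => Xe.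
apply: le_trans (triple_norm_le_norm _) _.
by have := normr_ge0 (X - Y); lra.
Qed.

Lemma cluster_triple_norm (R : realType) n (X : nat -> triple R n) (Y : triple R n) :
  cluster (X @ \oo) Y ->
  forall (e : R) K, 0 < e -> exists2 k, (K <= k)%N & triple_norm (X k - Y) <= e.
Proof.
move=> clX e K e_gt0.
have tailX : (X @ \oo) [set Z | exists2 k, (K <= k)%N & Z = X k].
  by exists K => // k /= Kk; exists k.
by have [_ [[k Kk ->] Xke]] := clX _ _ tailX (triple_norm_nbhs Y e_gt0); exists k.
Qed.

(* The quantity |X k - Y| + K (g k - L) cannot increase, so it stays below rho. *)
Lemma trapped (R : realType) n (X : nat -> triple R n) (Y : triple R n)
    (g : nat -> R) (rho K L : R) (k0 : nat) : 0 <= K -> (forall k, L <= g k) ->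
  (forall k, triple_norm (X k - Y) <= rho ->
     triple_norm (X k.+1 - X k) <= K * (g k - g k.+1)) ->
  triple_norm (X k0 - Y) + K * (g k0 - L) <= rho ->
  forall k, (k0 <= k)%N -> triple_norm (X k - Y) <= rho.
Proof.
move=> K0 Lg stepX start k /subnKC <-.
have gap_ge0 j : 0 <= K * (g j - L) by rewrite mulr_ge0 ?subr_ge0.
suff : triple_norm (X (k0 + (k - k0))%N - Y) + K * (g (k0 + (k - k0))%N - L) <= rho.
  by have := gap_ge0 (k0 + (k - k0))%N; lra.
elim: (k - k0)%N => [|m IHm]; first by rewrite addn0.
have near_m : triple_norm (X (k0 + m)%N - Y) <= rho.
  by have := gap_ge0 (k0 + m)%N; lra.
have := stepX _ near_m; rewrite addnS => dX.
have : triple_norm (X (k0 + m).+1 - Y) <=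
    triple_norm (X (k0 + m).+1 - X (k0 + m)%N) + triple_norm (X (k0 + m)%N - Y).
  by rewrite -{1}[X (k0 + m).+1](subrK (X (k0 + m)%N)) -addrA triple_normD.
by lra.
Qed.

Theorem theorem3p5 (R : realType) (n s : nat) (lam : 'I_n -> R[i])
    (sigma_max eta_max etahat_max t theta_min theta_max : R)
    (X : nat -> triple R n) (Xbar : triple R n) :
  conjugate_ordered s lam ->
  let Lam := blkdiag_spectrum s lam in
  0 <= sigma_max < 1 -> 0 <= eta_max < 1 -> 0 <= etahat_max < 1 ->
  0 < t < 1 ->
  0 < theta_min -> theta_min < theta_max -> theta_max < 1 ->
  generated_by_newton_cg Lam sigma_max eta_max etahat_max t
    theta_min theta_max X ->
  domain Lam Xbar ->
  cluster (X @ \oo) Xbar ->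
  (forall W : 'M[R]_n, exists2 xi, tangent Lam Xbar xi & DG Lam Xbar xi = W) ->
  X @ \oo --> Xbar /\ G Lam Xbar = 0.
Proof.
move=> _ Lam _ _ /andP[_ eh1] /andP[t0 t1] th0 _ th1 [dom0 GX_neq0 stepX] _ clX surj.
pose g k := frob_norm (G Lam (X k)).
have descent k : domain Lam (X k) /\ domain Lam (X k.+1) /\ g k.+1 <= g k.
  elim: k => [|k [_ [domk _]]]; split=> //.
    exact: (step_descent eh1 t0 th0 dom0 (GX_neq0 0%N) (stepX 0%N)).
  exact: (step_descent eh1 t0 th0 domk (GX_neq0 k.+1) (stepX k.+1)).
have g_noninc k m : (k <= m)%N -> g m <= g k.
  move/subnKC <-; elim: (m - k)%N => [|j IHj]; first by rewrite addn0.
  by rewrite addnS; apply: le_trans IHj; have [_ []] := descent (k + j)%N.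
have near_cl := cluster_triple_norm clX.
(* Convergence of the iterates is derived with [L] as the limit level of [g], independently of
   [L = 0]. *)
pose L := frob_norm (G Lam Xbar).
have [C C_ge0 lipG] := lipschitz_near_G Xbar Lam.
have near_gap e K : 0 < e -> exists k, [/\ (K <= k)%N,
    triple_norm (X k - Xbar) <= e, g k <= L + e & L <= g k + e].
  move=> e_gt0; pose d := Num.min 1 (Num.min e (e / (C + 1))).
  have C1_gt0 : 0 < C + 1 by rewrite ltr_wpDl.
  have d_gt0 : 0 < d by rewrite !lt_min ltr01 e_gt0 divr_gt0.
  have [k Kk] := near_cl d K d_gt0; rewrite !le_min => /and3P[Xk1 Xke XkC].
  have GXk : frob_norm (G Lam (X k) - G Lam Xbar) <= e.
    apply: le_trans (lipG _ Xk1) _; rewrite ler_pdivlMr // in XkC.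
    by have := triple_norm_ge0 (X k - Xbar); lra.
  exists k; split=> //; rewrite /g /L.
    rewrite -{1}[G Lam (X k)](subrK (G Lam Xbar)); apply: le_trans (frob_normD _ _) _; lra.
  rewrite -{1}[G Lam Xbar](subrK (G Lam (X k))); apply: le_trans (frob_normD _ _) _.
  by rewrite frob_distC; lra.
(* Iterates arbitrarily late come close to [Xbar], where [g] is almost [L], and [g] is
   nonincreasing. *)
have L_le k : L <= g k.
  apply/ler_addgt0Pr => e e_gt0; have [m [km _ _ Lm]] := near_gap e k e_gt0.
  by apply: le_trans Lm _; rewrite lerD2r g_noninc.
(* The uniform bound [g0] is the initial value of [g], valid along the whole sequence by
   monotonicity. *)
have [delta [K [c [delta_gt0 K_gt0 c_gt0 local]]]] :=
  step_near sigma_max eta_max eh1 t0 t1 th0 th1 (gap_gt0 (GX_neq0 0%N)) surj.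
have localX k : triple_norm (X k - Xbar) <= delta ->
    triple_norm (X k.+1 - X k) <= K * (g k - g k.+1) /\ g k.+1 <= (1 - c) * g k.
  move=> Xk; apply: local => //; first by have [] := descent k.
  exact: (g_noninc 0%N k).
split; last first.
  apply: frob_norm_eq0; apply/eqP; rewrite -/L eq_le frob_norm_ge0 andbT leNgt.
  (* At an iterate with [g k <= L + c * L / 2], one step removes at least [c * L] and would bring
     [g] strictly below [L]. *)
  apply/negP => L_gt0; pose e := Num.min delta (c * L / 2).
  have e_gt0 : 0 < e by rewrite lt_min delta_gt0 divr_gt0 ?mulr_gt0.
  have [k [_ + gk _]] := near_gap e 0%N e_gt0.
  rewrite le_min => /andP[/localX [_ gk1] _].
  have eL : e <= c * L / 2 by rewrite /e ge_min lexx orbT.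
  have := L_le k.+1; have := ler_wpM2l (ltW c_gt0) (L_le k).
  by have := mulr_gt0 c_gt0 L_gt0; lra.
apply/cvgrPdist_le => e e_gt0; pose rho := Num.min e delta.
have rho_gt0 : 0 < rho by rewrite lt_min e_gt0.
have K1_gt0 : 0 < 1 + K by rewrite addr_gt0.
(* Both the distance to [Xbar] and [g k0 - L] are at most [rho / (1 + K)], so the trapping quantity
   starts at most at [rho]. *)
have [k0 [_ Xk0 gk0 _]] := near_gap (rho / (1 + K)) 0%N (divr_gt0 rho_gt0 K1_gt0).
exists k0 => // k /= k0k; rewrite distrC; apply: le_trans (norm_le_triple_norm _) _.
apply: (@le_trans _ _ rho); last by rewrite /rho ge_min lexx.
apply: (@trapped _ _ _ _ g _ K L k0) => //; first exact: ltW.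
  move=> j Xj; have [|//] := localX j; apply: le_trans Xj _.
  by rewrite /rho ge_min lexx orbT.
have -> : rho = rho / (1 + K) + K * (rho / (1 + K)).
  by rewrite -{1}[rho / _]mul1r -mulrDl mulrCA mulfV ?mulr1 // lt0r_neq0.
rewrite lerD // ler_pM2l //; lra.
Qed.
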